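(* Consider the single-user average-reward problem of the context. Assume that for every subsidy $W$ an optimal solution is of threshold type, and that $S(\vec\Gamma)=\sum_{k=1}^K\sum_{r=1}^{\Gamma_k}\alpha^{\vec\Gamma}(\vec\pi_k^r)$ is non-decreasing in $\vec\Gamma$ (componentwise order). Then the problem is indexable, and Whittle's index $W(\vec\pi_j^\tau)$ is computed by the following algorithm. Set $\vec\Gamma^{-1}=\vec0$. Step $i$ ($i\ge0$): compute $$W_i=\inf_{\vec\Gamma\in\mathcal{T}(\vec\Gamma^{i-1})}\frac{F(\vec\Gamma^{i-1})-F(\vec\Gamma)}{S(\vec\Gamma)-S(\vec\Gamma^{i-1})},$$ let $\vec\Gamma^i$ be the largest minimizer, and set $W(\vec\pi_j^\tau):=W_i$ for each $j$ and $\tau$ with $\Gamma_j^{i-1}<\tau\le\Gamma_j^i$. If $\Gamma_j^i=\infty$ for all $j$ stop; otherwise go to Step $i+1$. When the algorithm stops, the Whittle index of every state $\vec\pi_j^\tau$ has been obtained and equals the value $W(\vec\pi_j^\tau)$ so assigned.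
   Context: Single-user model. Let $K\ge1$ and let $P$ be a $K\times K$ stochastic matrix with steady-state distribution $(p_1^s,\dots,p_K^s)$ (assumed to exist). For $j\in\{1,\dots,K\}$ and integer $\tau\ge1$ the belief state $\vec\pi_j^\tau=\vec e_jP^\tau$ means that the user was last observed $\tau$ slots ago in channel state $j$; belief states are labelled by the pairs $(j,\tau)$, and $\Pi$ is the set of all of them. In each slot an action $a\in\{0,1\}$ is chosen ($1$ active, $0$ passive). The average immediate reward is $R^1<\infty$ under $a=1$ and $R(\vec\pi_j^\tau,0)$ under $a=0$, with the standing assumption $R^1\ge R(\vec\pi_j^{\tau},0)\ge R(\vec\pi_j^{\tau'},0)\ge0$ for $\tau\le\tau'$. Transition law (approximating model): under $a=0$, $\vec\pi_j^\tau\to\vec\pi_j^{\tau+1}$ with probability 1; under $a=1$, $\vec\pi_j^\tau\to\vec\pi_k^1$ with probability $p_k^s$. Single-user average-reward problem (single-arm POMDP) with subsidy $W$: maximize the long-run expected average of the immediate reward plus $W$ for each passive slot. Threshold policy $\vec\Gamma=(\Gamma_1,\dots,\Gamma_K)$: passive in $\vec\pi_j^\tau$ if $\tau\le\Gamma_j$, active if $\tau>\Gamma_j$. $\alpha^{\vec\Gamma}(\vec\pi_j^\tau)$ is the steady-state probability of $\vec\pi_j^\tau$ under $\vec\Gamma$, and $$F(\vec\Gamma)=\sum_{k=1}^K\sum_{r=1}^{\Gamma_k}R(\vec\pi_k^r,0)\,\alpha^{\vec\Gamma}(\vec\pi_k^r)+R^1\sum_{k=1}^K\alpha^{\vec\Gamma}(\vec\pi_k^{\Gamma_k+1})$$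 is the steady-state expected immediate reward (without subsidy), so that the average reward of $\vec\Gamma$ with subsidy $W$ is $F(\vec\Gamma)+W\,S(\vec\Gamma)$. $\mathcal{T}(\vec\Gamma)$ is the set of $\vec\Gamma'\in(\mathbb{N}\cup\{0\})^K$ with $\vec\Gamma'\ne\vec\Gamma$ and $\Gamma'_j\ge\Gamma_j$ for all $j$; minimizers are allowed to have infinite components, with the corresponding quantities understood as limits. Indexability: with $\vec\Gamma(W)$ an optimal threshold policy for subsidy $W$ and $\mathcal{L}(W)=\{\vec\pi_j^\tau:\tau\le\Gamma_j(W)\}$ its passive set, $\mathcal{L}(W)\subseteq\mathcal{L}(W')$ for all $W<W'$. Whittle's index in $\vec\pi_j^\tau$: the smallest $W$ such that an optimal policy of the single-user problem is indifferent between the two actions in $\vec\pi_j^\tau$.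
   Formalization: All steady-state probabilities p_k^s are assumed positive: if some p_k^s = 0, the algorithm's quotient is 0/0 when only Γ_k changes, and the states of channel k have no smallest indifference subsidy. *)

(* Defs.v *)
(* MathComp / MathComp-Analysis *)
From HB Require Import structures.
From mathcomp Require Import all_boot all_order all_algebra.
From mathcomp Require Import all_classical all_reals all_analysis.

Set Implicit Arguments.
Unset Strict Implicit.
Unset Printing Implicit Defensive.

Import Order.TTheory GRing.Theory Num.Theory.
Import numFieldNormedType.Exports.

Local Open Scope classical_set_scope.
Local Open Scope ring_scope.

(* Single-user model; [passive_rew] is a function of the belief vector. *)
Record arm (R : realType) (K : nat) := Arm {
  chan : 'M[R]_K;
  steady : 'rV[R]_K;
  active_rew : R;
  passive_rew : 'rV[R]_K -> R }.

Definition prob_vector (R : realType) (K : nat) (v : 'rV[R]_K) : Prop :=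
  (forall j, 0 <= v 0 j) /\ \sum_j v 0 j = 1.

Definition stochastic (R : realType) (K : nat) (P : 'M[R]_K) : Prop :=
  forall i, prob_vector (row i P).

Definition steady_distribution (R : realType) (K : nat)
    (P : 'M[R]_K) (v : 'rV[R]_K) : Prop :=
  prob_vector v /\ v *m P = v.

Definition belief (R : realType) (K : nat) (M : arm R K) (j : 'I_K) (t : nat) :
    'rV[R]_K :=
  delta_mx 0 j *m chan M ^+ t.

Definition rew0 (R : realType) (K : nat) (M : arm R K) (j : 'I_K) (t : nat) : R :=
  passive_rew M (belief M j t).

Definition reward_assumption (R : realType) (K : nat) (M : arm R K) : Prop :=
  forall (j : 'I_K) (t t' : nat), (1 <= t <= t')%N ->
    [/\ rew0 M j t <= active_rew M, rew0 M j t' <= rew0 M j t & 0 <= rew0 M j t'].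

(* Labels (j, t) of the belief states; only the labels with 1 <= t, i.e. those
   in [Pi], are states of the problem. *)
Definition state (K : nat) : Type := ('I_K * nat)%type.

Definition Pi (K : nat) : set (state K) := [set s | (1 <= s.2)%N].

(* Expectation of f at the next state when action a is taken in s (true =
   active): this is the transition law. *)
Definition next_exp (R : realType) (K : nat) (M : arm R K) (a : bool) (s : state K)
    (f : state K -> R) : R :=
  if a then \sum_(k < K) steady M 0 k * f (k, 1%N) else f (s.1, s.2.+1).

Definition reward (R : realType) (K : nat) (M : arm R K) (W : R) (a : bool)
    (s : state K) : R :=
  if a then active_rew M else rew0 M s.1 s.2 + W.

(* History-dependent randomized policies: the probability of the active action
   given the past (state, action) pairs and the current state. *)
Definition policy (R : realType) (K : nat) : Type :=
  seq (state K * bool) -> state K -> R.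

Definition is_policy (R : realType) (K : nat) (u : policy R K) : Prop :=
  forall h s, 0 <= u h s <= 1.

(* Expected total reward, with subsidy W, over n slots from state s, past h. *)
Fixpoint total (R : realType) (K : nat) (M : arm R K) (W : R) (u : policy R K)
    (n : nat) (h : seq (state K * bool)) (s : state K) {struct n} : R :=
  if n is m.+1 then
    let cont (a : bool) :=
      reward M W a s + next_exp M a s (total M W u m (rcons h (s, a))) in
    u h s * cont true + (1 - u h s) * cont false
  else 0.

Definition avg_reward (R : realType) (K : nat) (M : arm R K) (W : R)
    (u : policy R K) (s : state K) : \bar R :=
  limn_einf (fun n => (total M W u n [::] s / n%:R)%:E).

Definition optimal (R : realType) (K : nat) (M : arm R K) (W : R)
    (u : policy R K) : Prop :=
  is_policy u /\
  forall u' : policy R K, is_policy u' ->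
    forall s, Pi s -> (avg_reward M W u' s <= avg_reward M W u s)%E.

(* Thresholds may be infinite; None is +oo. *)
Definition ethr (K : nat) : Type := 'I_K -> option nat.

Definition leo (x y : option nat) : bool :=
  if y is Some n then (if x is Some m then (m <= n)%N else false) else true.

Definition le_ethr (K : nat) (G G' : ethr K) : Prop := forall k, leo (G k) (G' k).

Definition fin_ethr (K : nat) (g : 'I_K -> nat) : ethr K := fun k => Some (g k).

Definition passive_set (K : nat) (G : ethr K) : set (state K) :=
  [set s | Pi s /\ leo (Some s.2) (G s.1)].

Definition thr_action (K : nat) (G : ethr K) (s : state K) : bool :=
  ~~ leo (Some s.2) (G s.1).

Definition thr_policy (R : realType) (K : nat) (G : ethr K) : policy R K :=
  fun _ s => (thr_action G s)%:R.

(* a is the stationary distribution on Pi of the chain induced by G. *)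
Definition thr_steady_state (R : realType) (K : nat) (M : arm R K) (G : ethr K)
    (a : state K -> R) : Prop :=
  [/\ forall s, Pi s -> 0 <= a s,
      \esum_(s in @Pi K) (a s)%:E = 1%E &
      forall s', Pi s' ->
        \esum_(s in @Pi K)
          (a s * next_exp M (thr_action G s) s (fun s2 => (s2 == s')%:R))%:E
        = (a s')%:E].

Section Performance.
Context (R : realType) (K : nat) (M : arm R K).
Context (alpha : ('I_K -> nat) -> state K -> R).

Definition Frew (g : 'I_K -> nat) : R :=
  \sum_(k < K) \sum_(1 <= r < (g k).+1) rew0 M k r * alpha g (k, r)
  + active_rew M * \sum_(k < K) alpha g (k, (g k).+1).

Definition Spas (g : 'I_K -> nat) : R :=
  \sum_(k < K) \sum_(1 <= r < (g k).+1) alpha g (k, r).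

(* Value at a possibly infinite threshold vector: the limit as the infinite
   components are replaced by n -> oo. *)
Definition extend (f : ('I_K -> nat) -> R) (G : ethr K) : R :=
  lim ((fun n : nat => f (fun k => odflt n (G k))) @ \oo).

Definition ratio (G G' : ethr K) : R :=
  (extend Frew G - extend Frew G') / (extend Spas G' - extend Spas G).

Definition Tset (G : ethr K) : set ('I_K -> nat) :=
  [set g | le_ethr G (fin_ethr g) /\ fin_ethr g <> G].

Definition minimizer (G : ethr K) (w : R) (G' : ethr K) : Prop :=
  [/\ le_ethr G G', G' <> G & ratio G G' = w].

Definition stopped (G : ethr K) : Prop := forall k, G k = None.

Definition alg_step (G : ethr K) (w : R) (G' : ethr K) : Prop :=
  [/\ w%:E = ereal_inf [set (ratio G (fin_ethr g))%:E | g in Tset G],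
      minimizer G w G' &
      forall G2, minimizer G w G2 -> le_ethr G2 G'].

(* The first n steps of the algorithm. G is shifted by one: step i goes from
   G i to G i.+1 and computes w i. *)
Definition alg_run (n : nat) (G : nat -> ethr K) (w : nat -> R) : Prop :=
  G 0%N = fin_ethr (fun _ => 0%N) /\
  forall i, (i < n)%N -> ~ stopped (G i) /\ alg_step (G i) (w i) (G i.+1).

Definition assigned (n : nat) (G : nat -> ethr K) (w : nat -> R)
    (s : state K) (v : R) : Prop :=
  exists i, [/\ (i < n)%N, ~~ leo (Some s.2) (G i s.1),
                leo (Some s.2) (G i.+1 s.1) & v = w i].

Definition tends_to (g : nat -> 'I_K -> nat) (G : ethr K) : Prop :=
  forall k, match G k with
            | Some m => \forall n \near \oo, g n k = m
            | None => (fun n => g n k) @ \oo --> \oo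
            end.

(* Frew has a limit at every infinite threshold vector, however it is approached. *)
Definition limits_exist : Prop :=
  forall (G : ethr K) (g : nat -> 'I_K -> nat), tends_to g G ->
    Frew (g n) @[n --> \oo] --> extend Frew G.

End Performance.

(* One selection W |-> G W of optimal threshold policies is required, not all:
   for large W several incomparable vectors with infinite components can be
   optimal at once, so arbitrary tie-breaking cannot give nested passive sets. *)
Definition indexable (R : realType) (K : nat) (M : arm R K) : Prop :=
  exists G : R -> ethr K,
    (forall W, optimal M W (thr_policy R (G W))) /\
    (forall W W', W < W' -> passive_set (G W) `<=` passive_set (G W')).

(* Both actions are prescribed in s by optimal threshold policies. Arbitrary
   policies are not allowed here: the long-run average does not see the action
   taken in a state that the policy visits only finitely often, whereas a
   threshold policy that is passive in (j, t) goes through (j, t) whenever j is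
   observed. *)
Definition indifferent (R : realType) (K : nat) (M : arm R K) (W : R)
    (s : state K) : Prop :=
  (exists G : ethr K, optimal M W (thr_policy R G) /\ ~~ thr_action G s) /\
  (exists G : ethr K, optimal M W (thr_policy R G) /\ thr_action G s).

Definition whittle_index (R : realType) (K : nat) (M : arm R K) (s : state K)
    (w : R) : Prop :=
  indifferent M w s /\ forall w', indifferent M w' s -> w <= w'.

(* Main.v *)
Require Import Defs.
From HB Require Import structures.
From mathcomp Require Import all_boot all_order all_algebra.
From mathcomp Require Import all_classical all_reals all_analysis.
From mathcomp Require Import ring lra.

Set Implicit Arguments.
Unset Strict Implicit.
Unset Printing Implicit Defensive.

Import Order.TTheory GRing.Theory Num.Theory.
Import numFieldNormedType.Exports.

Local Open Scope classical_set_scope.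
Local Open Scope ring_scope.

(** Each active slot restarts the arm: the next observed channel is drawn from
    the steady-state distribution p, whatever the current state. A finite
    threshold vector g therefore generates i.i.d. cycles of expected length
    L(g) = 1 + sum_k p_k g_k ([cycle_length]) and expected unsubsidised reward
    A(g) = R^1 + sum_k p_k sum_(1 <= t <= g_k) r_k(t) ([cycle_reward]), where
    r_k(t) is the passive reward in state (k, t). The stationary distribution
    gives F = A / L and S = 1 - 1 / L ([Frew_cycle], [Spas_cycle]), and the
    average reward under subsidy W is W + (A(g) - W) / L(g)
    ([avg_reward_fin]).

    The supremum c(W) over g of (A(g) - W) / L(g) is the critical level
    ([critical_level]); c(W) + W is the optimal average reward, because the
    truncated sums of r_k(t) - c are a bias function for the optimality
    inequalities ([avg_reward_le_critical]). Everything is governed by the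
    surplus A(g) - c L(g): since every r_k is non-increasing, g maximises it
    exactly when g is passive where r > c and active where r < c
    ([surplus_max], [surplus_maximal_separates]).

    Indexability. c(W) is non-increasing in W, so the superlevel sets of r at
    c(W) grow with W, and they are optimal passive sets whenever the supremum
    is attained. When it is not, the optimal threshold policy supplied by the
    hypothesis has an infinite component, c(W) is the largest of the limits of
    the r_k, and the superlevel set is enlarged by all states of the channels
    that reach this limit ([selected_optimal], [selected_nested]).

    Whittle's index. Let g be the strict superlevel set of r at v. At the
    subsidy A(g) - v L(g) the critical level is v, so both actions are optimal
    where r = v; at any smaller subsidy the critical level is larger than v and
    every optimal threshold policy is active there
    ([superlevel_whittle_index]).

    The algorithm. Let g be the strict superlevel set of r at
    v = max_k r_k(g_k + 1). For a finite g' above g the quotient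
    (F(g) - F(g')) / (S(g') - S(g)) equals A(g) - L(g) m, where m is the
    average of the rewards gained from g to g', weighted by p
    ([ratio_fin] expresses this through the surplus). Its infimum is
    A(g) - v L(g), the index of the level v, and the minimisers are the vectors
    that only gain states with r = v. The largest minimiser therefore is the
    set where r >= v ([alg_step_level]), which, if finite, is the strict
    superlevel set at the next lower level. An infinite component of the largest minimiser forces
    all its components to be infinite, since a finite component could otherwise
    be raised without changing the limits of F and S. *)

(** * Limits and sums *)

(** Turns the balance equations, which are sums over infinitely many states,
    into finite sums. *)
Lemma esum_finite_support (R : realType) (T : choiceType) (D : set T)
    (r : seq T) (f : T -> \bar R) :
  uniq r -> (forall x, x \in r -> D x) -> (forall x, D x -> 0 <= f x)%E ->
  (forall x, D x -> x \notin r -> f x = 0%E) ->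
  (\esum_(x in D) f x = \sum_(x <- r) f x)%E.
Proof.
move=> ur rD f0 fr.
have -> : (\esum_(x in D) f x = \esum_(x in [set` r]) f x)%E.
  rewrite esum_mkcond [RHS]esum_mkcond; apply: eq_esum => x _.
  have [xr|xr] := boolP (x \in r).
    rewrite (mem_set (rD _ xr)) mem_set//.
  rewrite [in RHS]memNset; last exact/negP.
  by case: ifPn => // /set_mem Dx; exact: fr.
rewrite esum_fset; [by rewrite (fsbig_seq _ _ ur)| |].
  exact: finite_seq.
by move=> x /[!inE] /= /rD; exact: f0.
Qed.

Lemma limn_einf_le_cvg (R : realType) (u v : nat -> R) (l : R) :
  (forall n, u n <= v n) -> v @ \oo --> l ->
  (limn_einf (fun n => (u n)%:E) <= l%:E)%E.
Proof.
move=> uv vl.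
have vl' : (EFin \o v) @ \oo --> l%:E by apply: cvg_EFin => //; exact: nearW.
have <- := (cvg_limn_einf_sup vl').1.
rewrite !limn_einf_lim.
apply: lee_lim; [exact: is_cvg_einfs|exact: is_cvg_einfs|].
apply: nearW => n; apply: le_ereal_inf_tmp => _ [m /= mn <-].
by apply: ge_ereal_inf; exists (u m)%:E; rewrite ?lee_fin//; exists m.
Qed.

Lemma limn_einf_ge_cvg (R : realType) (u v : nat -> R) (l : R) :
  (forall n, v n <= u n) -> v @ \oo --> l ->
  (l%:E <= limn_einf (fun n => (u n)%:E))%E.
Proof.
move=> uv vl.
have vl' : (EFin \o v) @ \oo --> l%:E by apply: cvg_EFin => //; exact: nearW.
have <- := (cvg_limn_einf_sup vl').1.
rewrite !limn_einf_lim.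
apply: lee_lim; [exact: is_cvg_einfs|exact: is_cvg_einfs|].
apply: nearW => n; apply: le_ereal_inf_tmp => _ [m /= mn <-].
by apply: ge_ereal_inf; exists (v m)%:E; rewrite ?lee_fin//; exists m.
Qed.

(** The bounds on the total reward over n slots are n a + b with b independent
    of n; b comes from the bias and disappears in the average. *)
Lemma cvg_affine_mean (R : realType) (a b : R) :
  (n%:R * a + b) / n%:R @[n --> \oo] --> a.
Proof.
rewrite -cvg_shiftS /=.
have : a + b * (@harmonic R n) @[n --> \oo] --> a + b * 0.
  by apply: cvgD; [exact: cvg_cst|apply: cvgMr; exact: cvg_harmonic].
rewrite mulr0 addr0; apply: cvg_trans; apply: near_eq_cvg; apply: nearW => n /=.
by rewrite /harmonic mulrDl mulrAC mulfV ?mul1r// pnatr_eq0.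
Qed.

Lemma cvg_div_nat (R : realType) (a : R) : a / n%:R @[n --> \oo] --> 0.
Proof.
rewrite -cvg_shiftS /=.
have : a * (@harmonic R n) @[n --> \oo] --> a * 0.
  by apply: cvgMr; exact: cvg_harmonic.
by rewrite mulr0.
Qed.

Lemma cvg_sum_ord (R : realType) (K : nat) (f : 'I_K -> nat -> R)
    (l : 'I_K -> R) :
  (forall k, f k n @[n --> \oo] --> l k) ->
  \sum_k f k n @[n --> \oo] --> \sum_k l k.
Proof. by move=> fl; apply: cvg_big => //; exact: add_continuous. Qed.

Lemma multiple_ratio_cvg (R : realType) (m : nat) :
  (m * n)%:R / n%:R @[n --> \oo] --> (m%:R : R).
Proof.
apply: (@cvg_trans _ (m%:R @[n --> \oo])); last exact: cvg_cst.
apply: near_eq_cvg; near=> n.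
have n0 : 0 < n%:R :> R by rewrite ltr0n; near: n; exists 1%N.
by rewrite natrM mulfK// gt_eqF.
Unshelve. all: by end_near. Qed.

(** * Threshold vectors *)

(** Thresholds are stated on t >= 1 only: t = 0 labels no belief state, and the
    threshold 0 already means active everywhere. *)
Lemma threshold_exists (K : nat) (P : 'I_K -> nat -> bool) :
  (forall k t t', (1 <= t <= t')%N -> P k t' -> P k t) ->
  exists G : ethr K, forall k t, (1 <= t)%N -> leo (Some t) (G k) = P k t.
Proof.
move=> Pdec.
have h k : exists x : option nat, forall t, (1 <= t)%N -> leo (Some t) x = P k t.
  have [all|] := pselect (forall t, (1 <= t)%N -> P k t).
    by exists None => t t1; rewrite all.
  move=> /existsNP[t0 /not_implyP[t01 /negP nP]].
  have ex : exists t, ~~ P k t.+1 by exists t0.-1; rewrite prednK.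
  exists (Some (ex_minn ex)) => -[//|t] _ /=; case: ex_minnP => m nm mmin.
  apply/idP/idP => [tm|Pt].
    by apply: contraLR tm => /mmin; rewrite ltnNge negbK.
  by rewrite ltnNge; apply: contra nm => mt; apply: Pdec Pt; rewrite ltnS.
by have [G hG] := choice h; exists G.
Qed.

Lemma fin_ethrP (K : nat) (G : ethr K) : (forall k, G k <> None) ->
  exists g, G = fin_ethr g.
Proof.
move=> hG; exists (fun k => odflt 0%N (G k)); apply/funext => k.
by rewrite /fin_ethr; move: (hG k); case: (G k).
Qed.

Lemma ethr_ext (K : nat) (G G' : ethr K) :
  (forall k t, (1 <= t)%N -> leo (Some t) (G k) = leo (Some t) (G' k)) -> G = G'.
Proof.
move=> h; apply/funext => k; move: (h k) => {h}.
case: (G k) (G' k) => [m|] [m'|] //= h.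
- congr Some; apply/eqP; rewrite eqn_leq; apply/andP; split.
    by case: m h => // m h; rewrite -h.
  by case: m' h => // m' h; rewrite h.
- by have := h m.+1 isT; rewrite ltnn.
- by have := h m'.+1 isT; rewrite ltnn.
Qed.

Lemma fin_ethr_inj (K : nat) (g g' : 'I_K -> nat) :
  fin_ethr g = fin_ethr g' -> g = g'.
Proof. by move=> h; apply/funext => k; have := congr1 (@^~ k) h; case. Qed.

Definition set_threshold (K : nat) (g : 'I_K -> nat) (k : 'I_K) (n : nat) :
    'I_K -> nat :=
  fun j => if j == k then n else g j.

Lemma set_threshold_id (K : nat) (g : 'I_K -> nat) (k : 'I_K) :
  set_threshold g k (g k) = g.
Proof. by apply/funext => j; rewrite /set_threshold; case: eqP => // ->. Qed.

Lemma le_set_threshold (K : nat) (g : 'I_K -> nat) (k : 'I_K) (t : nat) :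
  (g k <= t)%N -> le_ethr (fin_ethr g) (fin_ethr (set_threshold g k t)).
Proof. by move=> gt j /=; rewrite /set_threshold; case: eqP => // ->. Qed.

Lemma set_threshold_neq (K : nat) (g : 'I_K -> nat) (k : 'I_K) (t : nat) :
  (g k < t)%N -> set_threshold g k t <> g.
Proof.
move=> gt /(congr1 (@^~ k)); rewrite /set_threshold eqxx => tg.
by move: gt; rewrite tg ltnn.
Qed.

(** * Cycles, bias and verification of average rewards *)

Section model.
Context (R : realType) (K : nat) (M : arm R K).
Implicit Types (g : 'I_K -> nat) (s : state K) (W c : R).

Local Notation p k := (steady M 0 k).
Local Notation r := (rew0 M).

Definition cycle_reward g : R :=
  active_rew M + \sum_k p k * \sum_(1 <= t < (g k).+1) r k t.

Definition cycle_length g : R := 1 + \sum_k p k * (g k)%:R.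

(** The relative value of state s when a passive slot is worth r - c and the
    cycle ends once the threshold is passed. *)
Definition bias c g s : R := \sum_(s.2 <= t < (g s.1).+1) (r s.1 t - c).

Lemma bias_active c g s : (g s.1 < s.2)%N -> bias c g s = 0.
Proof. by move=> h; rewrite /bias big_geq. Qed.

Lemma bias_passive c g s : (s.2 <= g s.1)%N ->
  bias c g s = r s.1 s.2 - c + bias c g (s.1, s.2.+1).
Proof. by move=> h; rewrite /bias big_ltn. Qed.

Context (hp : steady_distribution (chan M) (steady M)).

Lemma steady_sum : \sum_k p k = 1.
Proof. by case: hp => -[]. Qed.

Lemma steady_ge0 k : 0 <= p k.
Proof. by case: hp => -[]. Qed.

Lemma channels_gt0 : (0 < K)%N.
Proof.
rewrite lt0n; apply/eqP => K0; move: steady_sum.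
rewrite big1 => [/esym/eqP|[k k_lt_K] _]; first by rewrite oner_eq0.
by exfalso; move: k_lt_K; rewrite K0.
Qed.

(** Links the bias to the cycle: the expected bias after a restart, plus the
    net reward R^1 - c of the active slot, is A(g) - c L(g). *)
Lemma bias_restart c g :
  \sum_k p k * bias c g (k, 1%N) =
  cycle_reward g - active_rew M - c * (cycle_length g - 1).
Proof.
rewrite /cycle_reward /cycle_length.
under eq_bigr => k _ do rewrite /bias /= sumrB sumr_const_nat subn1 mulrBr.
rewrite sumrB [active_rew M + _]addrC addrK [1 + _]addrC addrK mulr_sumr.
congr (_ - _); apply: eq_bigr => k _.
by rewrite -[c *+ _]mulr_natr; ring.
Qed.

Lemma cycle_length_ge1 g : 1 <= cycle_length g.
Proof. by rewrite lerDl sumr_ge0// => k _; rewrite mulr_ge0// steady_ge0. Qed.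

Lemma cycle_length_gt0 g : 0 < cycle_length g.
Proof. exact: lt_le_trans (cycle_length_ge1 g). Qed.

Lemma avg_reward_le W u s a b :
  (forall n, Defs.total M W u n [::] s <= n%:R * a + b) ->
  (avg_reward M W u s <= a%:E)%E.
Proof.
move=> h; apply: (limn_einf_le_cvg _ (@cvg_affine_mean _ a b)) => n.
by rewrite ler_wpM2r ?invr_ge0.
Qed.

Lemma avg_reward_ge W u s a b :
  (forall n, n%:R * a + b <= Defs.total M W u n [::] s) ->
  (a%:E <= avg_reward M W u s)%E.
Proof.
move=> h; apply: (limn_einf_ge_cvg _ (@cvg_affine_mean _ a b)) => n.
by rewrite ler_wpM2r ?invr_ge0.
Qed.

(** One step of the Bellman operator, for a randomised decision that is active
    with probability x. *)
Definition decision_value W (h : state K -> R) (x : R) s : R :=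
  x * (reward M W true s + next_exp M true s h) +
  (1 - x) * (reward M W false s + next_exp M false s h).

Lemma next_exp_le a s (f f' : state K -> R) : Pi s ->
  (forall s, Pi s -> f s <= f' s) -> next_exp M a s f <= next_exp M a s f'.
Proof.
move=> Ps ff'; case: a => /=; last exact: ff'.
by apply: ler_sum => k _; rewrite ler_wpM2l ?steady_ge0 ?ff'.
Qed.

Lemma next_exp_affine a s (f : state K -> R) (c : R) :
  next_exp M a s (fun s => c + f s) = c + next_exp M a s f.
Proof.
case: a => //=; under eq_bigr => k _ do rewrite mulrDr.
by rewrite big_split -mulr_suml steady_sum mul1r.
Qed.

Lemma totalS W u n l s :
  Defs.total M W u n.+1 l s =
  u l s * (reward M W true s +
           next_exp M true s (Defs.total M W u n (rcons l (s, true)))) +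
  (1 - u l s) * (reward M W false s +
           next_exp M false s (Defs.total M W u n (rcons l (s, false)))).
Proof. by []. Qed.

(** Verification by a bias function: if h is bounded below and the Bellman
    step never exceeds a + h, then the total reward grows at most at rate a.
    The policy may depend on the history because h does not. *)
Lemma total_le W u (h : state K -> R) (a b : R) : is_policy u ->
  (forall s, Pi s -> - b <= h s) ->
  (forall l s, Pi s -> decision_value W h (u l s) s <= a + h s) ->
  forall n l s, Pi s -> Defs.total M W u n l s <= n%:R * a + b + h s.
Proof.
move=> pu hb hs; elim=> [|n IH] l s Ps.
  by rewrite /= mul0r add0r addrC -lerBlDr sub0r hb.
have [u0 u1] := andP (pu l s); rewrite totalS.
have -> : n.+1%:R * a + b + h s = (n%:R * a + b) + (a + h s).
  by rewrite -natr1; ring.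
apply: le_trans (lerD (lexx _) (hs l s Ps)).
have cont_le b' : next_exp M b' s (Defs.total M W u n (rcons l (s, b'))) <=
    (n%:R * a + b) + next_exp M b' s h.
  by rewrite -next_exp_affine; apply: next_exp_le => // s' /IH.
have /(ler_wpM2l u0) ht := cont_le true.
have u1' : 0 <= 1 - u l s by rewrite subr_ge0.
have /(ler_wpM2l u1') hf := cont_le false.
rewrite /decision_value; move: ht hf.
set x := next_exp _ _ _ (Defs.total _ _ _ _ _).
set y := next_exp _ _ _ (Defs.total _ _ _ _ _).
set x' := next_exp _ _ _ _; set y' := next_exp _ _ _ _.
set ut := u l s; set rt := reward _ _ _ _; set rf := reward _ _ _ _.
by move=> h1 h2; lra.
Qed.

Lemma total_ge W u (h : state K -> R) (a b : R) : is_policy u ->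
  (forall s, Pi s -> h s <= b) ->
  (forall l s, Pi s -> a + h s <= decision_value W h (u l s) s) ->
  forall n l s, Pi s -> n%:R * a - b + h s <= Defs.total M W u n l s.
Proof.
move=> pu hb hs; elim=> [|n IH] l s Ps.
  by rewrite /= mul0r add0r addrC subr_le0 hb.
have [u0 u1] := andP (pu l s); rewrite totalS.
have -> : n.+1%:R * a - b + h s = (n%:R * a - b) + (a + h s).
  by rewrite -natr1; ring.
apply: le_trans (lerD (lexx _) (hs l s Ps)) _.
have cont_ge b' : (n%:R * a - b) + next_exp M b' s h <=
    next_exp M b' s (Defs.total M W u n (rcons l (s, b'))).
  by rewrite -next_exp_affine; apply: next_exp_le => // s' /IH.
have /(ler_wpM2l u0) ht := cont_ge true.
have u1' : 0 <= 1 - u l s by rewrite subr_ge0.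
have /(ler_wpM2l u1') hf := cont_ge false.
rewrite /decision_value; move: ht hf.
set x := next_exp _ _ _ (Defs.total _ _ _ _ _).
set y := next_exp _ _ _ (Defs.total _ _ _ _ _).
set x' := next_exp _ _ _ _; set y' := next_exp _ _ _ _.
set ut := u l s; set rt := reward _ _ _ _; set rf := reward _ _ _ _.
by move=> h1 h2; lra.
Qed.

Lemma thr_is_policy (G : ethr K) : is_policy (thr_policy R G).
Proof. by move=> l s; rewrite /thr_policy; case: thr_action; rewrite ?lexx ler01. Qed.

Lemma decision_value_thr W h (G : ethr K) l s :
  decision_value W h (thr_policy R G l s) s =
  reward M W (thr_action G s) s + next_exp M (thr_action G s) s h.
Proof.
rewrite /thr_policy /decision_value; case: thr_action => /=.
  by rewrite subrr mul0r addr0 mul1r.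
by rewrite subr0 mul0r add0r mul1r.
Qed.

End model.

(** * Stationary distributions of threshold policies *)

Section stationary.
Context (R : realType) (K : nat) (M : arm R K).
Context (hp : steady_distribution (chan M) (steady M)).
Context (g : 'I_K -> nat) (a : state K -> R).
Context (ha : thr_steady_state M (fin_ethr g) a).

Local Notation p k := (steady M 0 k).

(** The stationary distribution vanishes elsewhere, because the chain restarts
    from the first active state of each channel. *)
Definition visited : seq (state K) :=
  [seq (j, t) | j <- enum 'I_K, t <- iota 1 (g j).+1].

Lemma uniq_visited : uniq visited.
Proof.
apply: (@allpairs_uniq_dep _ (fun _ => nat)).
- exact: enum_uniq.
- by move=> j _; exact: iota_uniq.
- by move=> [j t] [j' t'] _ _ /= [-> ->].
Qed.

Lemma mem_visited s : (s \in visited) = (1 <= s.2 <= (g s.1).+1)%N.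
Proof.
apply/allpairsPdep/idP => [[j [t [_ + ->]]]|h].
  by rewrite mem_iota /= add1n ltnS.
by exists s.1, s.2; rewrite mem_enum mem_iota add1n ltnS h -surjective_pairing.
Qed.

(** The only predecessor of (k, t.+1) with t > 0 is (k, t), and only if (k, t)
    is passive. *)
Lemma steady_state_step k t : (0 < t)%N ->
  a (k, t.+1) = if (t <= g k)%N then a (k, t) else 0.
Proof.
move=> t0; case: ha => a0 _ /(_ (k, t.+1) isT) bal; apply: EFin_inj.
rewrite -bal.
rewrite (esum_finite_support (r := [:: (k, t)])) //; first last.
- move=> s Ps; rewrite inE => sk; rewrite /next_exp /thr_action /=.
  case: ifP => _.
    by rewrite big1 ?mulr0// => j _; rewrite xpair_eqE /= eqSS (ltn_eqF t0) andbF mulr0.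
  case: s sk Ps => j u /= ; rewrite !xpair_eqE eqSS => /negbTE -> _.
  by rewrite mulr0.
- move=> s Ps; rewrite lee_fin mulr_ge0 ?a0// /next_exp.
  case: ifP => _; last by rewrite ler0n.
  by rewrite sumr_ge0// => j _; rewrite mulr_ge0// steady_ge0.
- by move=> s; rewrite inE => /eqP ->; rewrite /Pi /=.
rewrite big_seq1 /next_exp /thr_action /=; case: (leqP t (g k)) => _ /=.
  by rewrite eqxx mulr1.
by rewrite big1 ?mulr0// => j _; rewrite xpair_eqE /= eqSS (ltn_eqF t0) andbF mulr0.
Qed.

Lemma steady_state_const k t : (t <= g k)%N -> a (k, t.+1) = a (k, 1%N).
Proof.
elim: t => // t IH tg; rewrite steady_state_step// tg IH//; exact: ltnW.
Qed.

Lemma steady_state_out k t : ((g k).+1 < t)%N -> a (k, t) = 0.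
Proof.
case: t => // t; rewrite ltnS => tg; rewrite steady_state_step.
  by rewrite leqNgt tg.
exact: leq_ltn_trans tg.
Qed.

Lemma esum_steady_state (q : state K -> R) : (forall s, Pi s -> 0 <= q s) ->
  (\esum_(s in @Pi K) (a s * q s)%:E =
   (\sum_k \sum_(1 <= t < (g k).+2) a (k, t) * q (k, t))%:E)%E.
Proof.
move=> q0; rewrite (esum_finite_support uniq_visited).
- rewrite big_allpairs_dep /= big_enum /= -sumEFin; apply: eq_bigr => k _.
  by rewrite sumEFin /index_iota subn1.
- by move=> s; rewrite mem_visited => /andP[].
- by move=> s Ps; case: ha => a0 _ _; rewrite lee_fin mulr_ge0 ?a0 ?q0.
- move=> s Ps; rewrite mem_visited negb_and -leqNgt -ltnNge.
  case/orP => [|h]; first by rewrite leqNgt Ps.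
  by case: s h {Ps} => k t h; rewrite steady_state_out ?mul0r.
Qed.

Lemma steady_state_restart k : a (k, 1%N) = p k * \sum_j a (j, (g j).+1).
Proof.
case: ha => a0 _ /(_ (k, 1%N) isT) bal; apply: EFin_inj.
rewrite -bal.
rewrite (esum_steady_state (q := fun s =>
  next_exp M (thr_action (fin_ethr g) s) s (fun s2 => (s2 == (k, 1%N))%:R)));
  last first.
  move=> s Ps; rewrite /next_exp; case: ifP => _; last by rewrite ler0n.
  by rewrite sumr_ge0// => j _; rewrite mulr_ge0// steady_ge0.
congr EFin; rewrite mulr_sumr; apply: eq_bigr => j _.
rewrite big_nat_recr //= big_nat big1 ?add0r.
  rewrite /next_exp /thr_action /= ltnn /= (bigD1 k) //= eqxx mulr1 big1 ?addr0.
    by rewrite mulrC.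
  by move=> i /negbTE ik; rewrite xpair_eqE ik mulr0.
move=> t /andP[t1]; rewrite ltnS /next_exp /thr_action /= => tg.
by rewrite tg /= xpair_eqE eqSS (gtn_eqF t1) andbF mulr0.
Qed.

(** Within a channel the mass is constant up to the first active state, and
    across channels it is proportional to p by the restart; the total mass 1
    fixes the constant. *)
Lemma steady_state_val k t : (1 <= t <= (g k).+1)%N ->
  a (k, t) = p k / cycle_length M g.
Proof.
case: t => // t; rewrite ltnS => /andP[_ tg]; rewrite steady_state_const//.
rewrite steady_state_restart; congr (_ * _).
set x := \sum_j _.
have [_ mass _] := ha.
have := @esum_steady_state (fun=> 1) (fun _ _ => ler01).
under eq_esum do rewrite mulr1.
rewrite mass => mass1; move: (EFin_inj mass1).
have -> : \sum_j \sum_(1 <= t0 < (g j).+2) a (j, t0) * 1 =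
          \sum_j p j * (g j).+1%:R * x.
  apply: eq_bigr => j _; rewrite big_nat.
  rewrite (eq_bigr (fun=> a (j, 1%N))); last first.
    by move=> [//|u]; rewrite ltnS => /andP[_ ug]; rewrite mulr1 steady_state_const.
  rewrite -big_nat sumr_const_nat subn1 /= steady_state_restart -/x.
  by rewrite -mulr_natr; ring.
rewrite -mulr_suml.
under eq_bigr => j _ do rewrite -natr1 mulrDr mulr1.
rewrite big_split /= steady_sum// addrC -/(cycle_length M g) => /esym lx.
have l0 := cycle_length_gt0 hp g.
by apply: (mulfI (lt0r_neq0 l0)); rewrite lx mulfV// gt_eqF.
Qed.

End stationary.

Section performance.
Context (R : realType) (K : nat) (M : arm R K).
Context (alpha : ('I_K -> nat) -> state K -> R).
Context (hp : steady_distribution (chan M) (steady M)).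
Context (halpha : forall g : 'I_K -> nat,
  thr_steady_state M (fin_ethr g) (alpha g)).
Local Notation p k := (steady M 0 k).

Lemma Frew_cycle g : Frew M alpha g = cycle_reward M g / cycle_length M g.
Proof.
rewrite /Frew /cycle_reward mulrDl addrC; congr (_ + _).
  congr (_ * _); under eq_bigr => k _ do rewrite (steady_state_val hp (halpha g)) ?leqnn//.
  by rewrite -mulr_suml steady_sum// mul1r.
rewrite mulr_suml; apply: eq_bigr => k _; rewrite mulr_sumr mulr_suml.
apply: eq_big_nat => t /andP[t1 tg].
by rewrite (steady_state_val hp (halpha g)) ?t1 1?ltnW//; ring.
Qed.

(** One slot per cycle is active, hence a fraction 1 / L(g) of all slots. *)
Lemma Spas_cycle g : Spas alpha g = 1 - (cycle_length M g)^-1.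
Proof.
have l0 := cycle_length_gt0 hp g.
have -> : 1 - (cycle_length M g)^-1 = (cycle_length M g - 1) / cycle_length M g.
  by field; rewrite gt_eqF.
rewrite /Spas {1}/cycle_length [1 + _]addrC addrK mulr_suml.
apply: eq_bigr => k _.
rewrite big_nat (eq_bigr (fun=> p k / cycle_length M g)); last first.
  by move=> t /andP[t1 tg]; rewrite (steady_state_val hp (halpha g)) ?t1 1?ltnW.
by rewrite -big_nat sumr_const_nat subn1 /= -mulr_natr; ring.
Qed.

End performance.

(** * Average rewards of threshold policies *)

Section values.
Context (R : realType) (K : nat) (M : arm R K).
Implicit Types (g : 'I_K -> nat) (s : state K) (W c : R).

Local Notation p k := (steady M 0 k).
Local Notation r := (rew0 M).

(** Comparing it with W compares the average reward under subsidy W with c + W;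
    unlike a quotient it is, up to a constant, a sum over the passive states,
    so it can be maximised state by state. *)
Definition surplus c g : R := cycle_reward M g - c * cycle_length M g.

Lemma surplusE c g : surplus c g =
  active_rew M - c + \sum_k p k * \sum_(1 <= t < (g k).+1) (r k t - c).
Proof.
rewrite /surplus /cycle_reward /cycle_length mulrDr mulr1 mulr_sumr.
rewrite [RHS](_ : _ = (active_rew M - c) +
  (\sum_k p k * \sum_(1 <= t < (g k).+1) r k t -
   \sum_k c * (p k * (g k)%:R))); first by ring.
congr (_ + _); rewrite -sumrB; apply: eq_bigr => k _.
by rewrite sumrB sumr_const_nat subn1 /= -mulr_natr; ring.
Qed.

Lemma surplus_set_thresholdS c g k n :
  surplus c (set_threshold g k n.+1) =
  surplus c (set_threshold g k n) + p k * (r k n.+1 - c).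
Proof.
rewrite !surplusE -[RHS]addrA; congr (_ + _).
rewrite (bigD1 k) //= [in RHS](bigD1 k) //= /set_threshold eqxx big_nat_recr //= mulrDr.
rewrite -!addrA; congr (_ + _); rewrite addrC; congr (_ + _).
by apply: eq_bigr => j /negbTE ->.
Qed.

Lemma surplus_dec c g k : (0 < g k)%N ->
  surplus c g = surplus c (set_threshold g k (g k).-1) + p k * (r k (g k) - c).
Proof.
move=> gk; rewrite -{1}(set_threshold_id g k) -(prednK gk).
exact: surplus_set_thresholdS.
Qed.

Lemma surplus_inc c g k :
  surplus c (set_threshold g k (g k).+1) =
  surplus c g + p k * (r k (g k).+1 - c).
Proof. by rewrite surplus_set_thresholdS set_threshold_id. Qed.

(** At reward exactly c both actions are allowed; this is the slack that makes
    two threshold vectors optimal for the same subsidy. *)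
Definition separates c g : Prop :=
  (forall k t, (1 <= t <= g k)%N -> c <= r k t) /\
  (forall k t, (g k < t)%N -> r k t <= c).

Context (hp : steady_distribution (chan M) (steady M)).

(** Up to a constant, the surplus is the sum of p_k (r_k(t) - c) over the passive states, and a
    separating g collects all positive terms and no negative one. *)
Lemma surplus_max c g g' : separates c g -> surplus c g' <= surplus c g.
Proof.
move=> [hge hle]; rewrite !surplusE lerD2l; apply: ler_sum => k _.
apply: ler_wpM2l; first exact: steady_ge0.
have [gg|/ltnW gg] := leqP (g k) (g' k).
  rewrite [leLHS](@big_cat_nat _ _ _ (g k).+1)//= gerDl big_nat sumr_le0// => t /andP[gt _].
  by rewrite subr_le0 hle.
rewrite [leRHS](@big_cat_nat _ _ _ (g' k).+1)//= lerDl big_nat sumr_ge0// => t /andP[gt gt'].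
by rewrite subr_ge0 hge// -[(t <= _)%N]ltnS gt' andbT (leq_trans _ gt).
Qed.

Lemma separates_surplus_eq c g g' : separates c g -> separates c g' ->
  surplus c g = surplus c g'.
Proof. by move=> h h'; apply/eqP; rewrite eq_le !surplus_max. Qed.

Lemma bias_bounded c g : exists b, forall s, Pi s -> `|bias M c g s| <= b.
Proof.
exists (\sum_k \sum_(1 <= t < (g k).+1) `|r k t - c|) => -[k t] t1.
apply: (@le_trans _ _ (\sum_(1 <= t < (g k).+1) `|r k t - c|)); last first.
  by rewrite [leRHS](bigD1 k)//= lerDl sumr_ge0// => j _; rewrite sumr_ge0.
rewrite /bias /=; have [gt|tg] := leqP (g k).+1 t.
  by rewrite big_geq// normr0 sumr_ge0.
apply: le_trans (ler_norm_sum _ _ _) _.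
by rewrite [leRHS](@big_cat_nat _ _ _ t)//= 1?ltnW// lerDr sumr_ge0.
Qed.

Lemma bias_ge0 c g s : separates c g -> Pi s -> 0 <= bias M c g s.
Proof.
move=> [hge _] s1; rewrite /bias big_nat sumr_ge0// => t /andP[st tg].
by rewrite subr_ge0 hge// (leq_trans s1 st).
Qed.

Lemma active_value W c g s :
  reward M W true s + next_exp M true s (bias M c g) = surplus c g + c.
Proof. by rewrite /= bias_restart// /surplus; ring. Qed.

Lemma passive_value W c g s : (s.2 <= g s.1)%N ->
  reward M W false s + next_exp M false s (bias M c g) = (c + W) + bias M c g s.
Proof. by move=> sg; rewrite /= [in RHS]bias_passive//; ring. Qed.

Lemma passive_value_out W c g s : (g s.1 < s.2)%N ->
  reward M W false s + next_exp M false s (bias M c g) = r s.1 s.2 + W.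
Proof. by move=> sg; rewrite /= bias_active ?addr0//= ltnW. Qed.

(** Holds for history-dependent randomised policies. If g separates the rewards
    at c, then passing from r - c to its positive part does not change the
    bias of g, so the bias satisfies the optimality inequality for both
    actions; an active slot earns surplus c g + c, which is at most c + W. *)
Lemma avg_reward_separates_le W c g u s : separates c g -> surplus c g <= W ->
  is_policy u -> Pi s -> (avg_reward M W u s <= (c + W)%:E)%E.
Proof.
move=> cg gW pu Ps; apply: (@avg_reward_le _ _ _ _ _ _ _ (bias M c g s)) => n.
rewrite -[_ * _]addr0; apply: total_le => // [s' Ps'|l s' Ps'].
  by rewrite oppr0 bias_ge0.
have [u0 u1] := andP (pu l s').
have b0 := bias_ge0 cg Ps'.
have act : reward M W true s' + next_exp M true s' (bias M c g) <=
    (c + W) + bias M c g s'.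
  by rewrite active_value; lra.
have pas : reward M W false s' + next_exp M false s' (bias M c g) <=
    (c + W) + bias M c g s'.
  have [sg|sg] := leqP s'.2 (g s'.1); first by rewrite passive_value.
  by rewrite passive_value_out//; have := cg.2 _ _ sg; lra.
have u1' : 0 <= 1 - u l s' by rewrite subr_ge0.
have := lerD (ler_wpM2l u0 act) (ler_wpM2l u1' pas); rewrite /decision_value.
by rewrite -mulrDl [u _ _ + _]addrC subrK mul1r.
Qed.

(** G may have infinite components, and may be passive beyond g as long as it
    earns at least c there; the bias of g is still a subsolution for G. *)
Lemma avg_reward_thr_ge W c g (G : ethr K) s : W <= surplus c g ->
  (forall s, Pi s -> thr_action G s -> (g s.1 < s.2)%N) ->
  (forall s, Pi s -> ~~ thr_action G s -> (g s.1 < s.2)%N -> c <= r s.1 s.2) ->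
  Pi s -> ((c + W)%:E <= avg_reward M W (thr_policy R G) s)%E.
Proof.
move=> Wg hact hpas Ps; have [b hb] := bias_bounded c g.
apply: (@avg_reward_ge _ _ _ _ _ _ _ (bias M c g s - b)) => n.
rewrite addrA addrAC; apply: total_ge => //.
- exact: thr_is_policy.
- by move=> s' /hb; exact/le_trans/ler_norm.
move=> l s' Ps'; rewrite decision_value_thr.
case: (boolP (thr_action G s')) => as'.
  by rewrite active_value bias_active ?hact//; lra.
have [sg|sg] := leqP s'.2 (g s'.1); first by rewrite passive_value.
by rewrite passive_value_out// bias_active//; have := hpas _ Ps' as' sg; lra.
Qed.

Lemma avg_reward_fin W g s : Pi s ->
  avg_reward M W (thr_policy R (fin_ethr g)) s =
  ((cycle_reward M g - W) / cycle_length M g + W)%:E.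
Proof.
move=> Ps; set c := _ / _.
have cW : surplus c g = W.
  by rewrite /surplus /c divfK ?gt_eqF ?cycle_length_gt0//; ring.
apply/eqP; rewrite eq_le; apply/andP; split; last first.
  apply: (@avg_reward_thr_ge _ _ g) => //; first by rewrite cW.
    by move=> s' _; rewrite /thr_action /= -ltnNge.
  by move=> s' _; rewrite /thr_action /= negbK => h; rewrite ltnNge h.
have [b hb] := bias_bounded c g.
apply: (@avg_reward_le _ _ _ _ _ _ _ (b + bias M c g s)) => n.
rewrite addrA; apply: total_le => //.
- exact: thr_is_policy.
- by move=> s' /hb; rewrite ler_norml => /andP[].
move=> l s' Ps'; rewrite decision_value_thr /thr_action /=.
case: (leqP s'.2 (g s'.1)) => sg.
  by rewrite passive_value.
by rewrite active_value bias_active// cW; lra.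
Qed.

End values.

(** * The critical level *)

Section index.
Context (R : realType) (K : nat) (M : arm R K).
Implicit Types (g : 'I_K -> nat) (s : state K) (W c : R).

Local Notation p k := (steady M 0 k).
Local Notation r := (rew0 M).

Context (hp : steady_distribution (chan M) (steady M)).
Context (hp_pos : forall k : 'I_K, 0 < p k).
Context (hR : reward_assumption M).

Lemma rew0_le k t t' : (1 <= t <= t')%N -> r k t' <= r k t.
Proof. by move/(hR k) => []. Qed.

Lemma rew0_ge0 k t : (1 <= t)%N -> 0 <= r k t.
Proof. by move=> t1; have [] := hR k (t := t) (t' := t); rewrite ?t1 ?leqnn. Qed.

Lemma rew0_le_active k t : (1 <= t)%N -> r k t <= active_rew M.
Proof. by move=> t1; have [] := hR k (t := t) (t' := t); rewrite ?t1 ?leqnn. Qed.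

(** Converse of [surplus_max]: changing one threshold by one changes the
    surplus by a single term p_k (r_k(t) - c), whose sign is then known, and
    monotonicity of r_k propagates the comparison. *)
Lemma surplus_maximal_separates c g :
  (forall g', surplus M c g' <= surplus M c g) -> separates M c g.
Proof.
move=> gmax; split=> k t => [tg|gt].
  apply: (@le_trans _ _ (r k (g k))); last exact: rew0_le.
  have gk : (0 < g k)%N by case/andP: tg => t1; exact: leq_trans.
  rewrite leNgt; apply/negP => h.
  have := gmax (set_threshold g k (g k).-1); rewrite (surplus_dec M c gk).
  have : p k * (r k (g k) - c) < 0 by rewrite pmulr_rlt0// subr_lt0.
  by lra.
apply: (@le_trans _ _ (r k (g k).+1)); first exact: rew0_le.
rewrite leNgt; apply/negP => h.
have := gmax (set_threshold g k (g k).+1).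
rewrite surplus_inc gerDl leNgt => /negP; apply.
by rewrite mulr_gt0// subr_gt0.
Qed.

(** The limit of the rewards along an uninterrupted passive run. It exists by
    monotonicity, although the beliefs themselves need not converge. *)
Definition rew_limit k : R := inf (range (fun n => r k n.+1)).

Lemma rew0_cvg k : r k n.+1 @[n --> \oo] --> rew_limit k.
Proof.
apply: nonincreasing_cvgn => [m n mn|]; first by apply: rew0_le; rewrite ltnS.
by exists 0 => _ [n _ <-]; apply: rew0_ge0.
Qed.

Lemma rew_limit_le k t : (1 <= t)%N -> rew_limit k <= r k t.
Proof.
case: t => // t _; apply: ge_inf; last by exists t.
by exists 0 => _ [n _ <-]; apply: rew0_ge0.
Qed.

Lemma rew0_lt k c : rew_limit k < c -> exists2 t, (1 <= t)%N & r k t < c.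
Proof.
move=> /inf_lt[|_ [n _ <-] nc]; last by exists n.+1.
by exists (r k 1%N); exists 0%N.
Qed.

Lemma passive_mean_cvg k :
  (\sum_(1 <= t < n.+1) r k t) / n%:R @[n --> \oo] --> rew_limit k.
Proof.
rewrite -cvg_shiftS /=; have := cesaro (@rew0_cvg k).
apply: cvg_trans; apply: near_eq_cvg; apply: nearW => n /=.
by rewrite /arithmetic_mean /= seriesEnat /= big_add1 mulrC.
Qed.

Definition superlevel c g : Prop :=
  forall k t, (1 <= t)%N -> (t <= g k)%N = (c < r k t).

(** The hypothesis excludes a channel whose rewards stay above c forever, for
    which the threshold would be infinite. *)
Lemma superlevel_exists c : (forall k, exists2 t, (1 <= t)%N & r k t <= c) ->
  exists g, superlevel c g.
Proof.
move=> hc; have [|G hG] := @threshold_exists K (fun k t => c < r k t).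
  by move=> k t t' tt' h; apply: lt_le_trans h _; exact: rew0_le.
have [|g Gg] := @fin_ethrP K G.
  move=> k Gk; have [t t1 rc] := hc k.
  by have := hG k t t1; rewrite Gk /= ltNge rc.
by exists g => k t t1; rewrite -(hG k t t1) Gg.
Qed.

Lemma superlevel_separates c g : superlevel c g -> separates M c g.
Proof.
move=> hg; split=> k t.
  by move=> /andP[t1]; rewrite hg// => /ltW.
move=> gt; have t1 : (1 <= t)%N by exact: leq_ltn_trans gt.
by rewrite leNgt -hg// -ltnNge.
Qed.

Lemma total_all_passive W (G : ethr K) k : G k = None ->
  forall n l t, Defs.total M W (thr_policy R G) n l (k, t) =
  \sum_(t <= i < t + n) r k i + n%:R * W.
Proof.
move=> Gk; elim=> [|n IH] l t.
  by rewrite /= addn0 big_geq// add0r mul0r.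
have u0 : thr_policy R G l (k, t) = 0 by rewrite /thr_policy /thr_action /= Gk.
rewrite totalS u0 mul0r add0r subr0 mul1r /= IH big_ltn ?addnS ?addSn ?ltnS ?leq_addr//.
by rewrite -natr1; ring.
Qed.

Lemma avg_reward_all_passive_le W (G : ethr K) k : G k = None ->
  (avg_reward M W (thr_policy R G) (k, 1%N) <= (rew_limit k + W)%:E)%E.
Proof.
move=> Gk; apply: (@limn_einf_le_cvg _
  (fun n => Defs.total M W (thr_policy R G) n [::] (k, 1%N) / n%:R)
  (fun n => (\sum_(1 <= t < n.+1) r k t) / n%:R + (n%:R * W + 0) / n%:R)).
  by move=> n; rewrite total_all_passive// add1n addr0 mulrDl.
by apply: cvgD; [exact: passive_mean_cvg|exact: cvg_affine_mean].
Qed.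

(** The supremum of the average rewards of finite threshold vectors, minus W.
    Without the shift by W it would not be monotone in the direction that
    makes its superlevel sets grow with W. *)
Definition critical_level W : R :=
  sup (range (fun g => (cycle_reward M g - W) / cycle_length M g)).

Lemma cycle_reward_le g : cycle_reward M g <= active_rew M * cycle_length M g.
Proof.
rewrite /cycle_reward /cycle_length mulrDr mulr1 lerD2l mulr_sumr.
apply: ler_sum => k _; rewrite mulrCA ler_wpM2l ?steady_ge0//.
rewrite mulr_natr.
apply: (@le_trans _ _ (\sum_(1 <= t < (g k).+1) active_rew M)).
  rewrite big_nat [leRHS]big_nat; apply: ler_sum => t /andP[t1 _].
  exact: rew0_le_active.
by rewrite sumr_const_nat subn1.
Qed.

(** The quotients are bounded because A(g) <= R^1 L(g) and L(g) >= 1. *)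
Lemma critical_level_has_sup W :
  has_sup (range (fun g => (cycle_reward M g - W) / cycle_length M g)).
Proof.
split; first exact: image_nonempty (ex_intro _ (fun=> 0%N) I).
exists (active_rew M + `|W|) => _ [g _ <-].
have l0 := cycle_length_gt0 hp g; have l1 := cycle_length_ge1 hp g.
rewrite ler_pdivrMr// mulrDl; apply: lerD; first exact: cycle_reward_le.
apply: le_trans (ler_norm _) _; rewrite normrN ler_peMr//.
Qed.

Lemma critical_level_ub W g : surplus M (critical_level W) g <= W.
Proof.
suff : cycle_reward M g - W <= critical_level W * cycle_length M g.
  by rewrite /surplus; lra.
rewrite -ler_pdivrMr ?cycle_length_gt0//.
by apply: ub_le_sup; [exact: (critical_level_has_sup W).2|exists g].
Qed.

Lemma critical_level_le W x :
  (forall g, (cycle_reward M g - W) / cycle_length M g <= x) ->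
  critical_level W <= x.
Proof.
move=> h; apply: ge_sup; first exact: (critical_level_has_sup W).1.
by move=> _ [g _ <-].
Qed.

Lemma critical_level_anti W W' : W <= W' ->
  critical_level W' <= critical_level W.
Proof.
move=> WW'; apply: critical_level_le => g.
have l0 := cycle_length_gt0 hp g.
rewrite ler_pdivrMr//.
have := critical_level_ub W g; rewrite /surplus; lra.
Qed.

(** If the critical level were below rew_limit k, each further passive slot in
    channel k would add at least a fixed positive amount to the surplus, which
    is bounded by W. *)
Lemma critical_level_ge_rew_limit W k : rew_limit k <= critical_level W.
Proof.
rewrite leNgt; apply/negP => lt_c; set c := critical_level W in lt_c.
have h n : n%:R * (p k * (rew_limit k - c)) <= W - active_rew M + c.
  have := critical_level_ub W (set_threshold (fun=> 0%N) k n); rewrite -/c surplusE.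
  rewrite (bigD1 k)//= /set_threshold eqxx [X in _ + (_ + X)]big1 ?addr0; last first.
    by move=> j /negbTE ->; rewrite big_geq ?mulr0.
  suff : n%:R * (p k * (rew_limit k - c)) <= p k * \sum_(1 <= t < n.+1) (r k t - c) by lra.
  rewrite mulrCA ler_wpM2l ?steady_ge0// mulr_natl.
  rewrite -[X in _ *+ X](subn1 n.+1) -sumr_const_nat big_nat [leRHS]big_nat.
  by apply: ler_sum => t /andP[t1 _]; rewrite lerB// rew_limit_le.
have d0 : 0 < p k * (rew_limit k - c) by rewrite mulr_gt0// subr_gt0.
set d := p k * _ in h d0; set b := _ + c in h.
have := h (Num.bound `|b / d|); rewrite leNgt => /negP; apply.
rewrite -ltr_pdivrMr//; apply: le_lt_trans (ler_norm _) _.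
exact: archi_boundP.
Qed.

(** The level is raised by an arbitrarily small e > 0: above all the limits of
    the rewards the superlevel set is finite and the bias is a finite sum,
    which may fail at the critical level itself. *)
Lemma avg_reward_le_critical W u s : is_policy u -> Pi s ->
  (avg_reward M W u s <= (critical_level W + W)%:E)%E.
Proof.
move=> pu Ps; apply/lee_addgt0Pr => e e0; rewrite -EFinD.
have [|g hg] := @superlevel_exists (critical_level W + e).
  move=> k; have [|t t1 /ltW h] := @rew0_lt k (critical_level W + e).
    by rewrite (le_lt_trans (critical_level_ge_rew_limit W k))// ltrDl.
  by exists t.
have -> : critical_level W + W + e = (critical_level W + e) + W by rewrite addrAC.
apply: avg_reward_separates_le (superlevel_separates hg) _ pu Ps => //.
apply: le_trans (critical_level_ub W g); rewrite /surplus lerD2l lerN2.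
by rewrite ler_pM2r ?cycle_length_gt0// lerDl ltW.
Qed.

Definition attained W : Prop := exists g, surplus M (critical_level W) g = W.

Lemma attained_optimal W g : surplus M (critical_level W) g = W ->
  optimal M W (thr_policy R (fin_ethr g)).
Proof.
move=> gW; split=> [|u pu s Ps]; first exact: thr_is_policy.
apply: le_trans (avg_reward_le_critical W pu Ps) _.
apply: (@avg_reward_thr_ge _ _ _ hp _ _ g) => //; first by rewrite gW.
  by move=> s' _; rewrite /thr_action /= -ltnNge.
by move=> s' _; rewrite /thr_action /= negbK => h; rewrite ltnNge h.
Qed.

Lemma optimal_fin_attained W g :
  optimal M W (thr_policy R (fin_ethr g)) -> surplus M (critical_level W) g = W.
Proof.
move=> [_ opt]; pose k := Ordinal (channels_gt0 hp).
suff : critical_level W <= (cycle_reward M g - W) / cycle_length M g.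
  rewrite ler_pdivlMr ?cycle_length_gt0// => h.
  by apply/eqP; rewrite eq_le critical_level_ub /surplus; lra.
apply: critical_level_le => g'.
have := opt _ (@thr_is_policy R K (fin_ethr g')) (k, 1%N) isT.
by rewrite !avg_reward_fin// lee_fin lerD2r.
Qed.

(** A passive policy in channel k earns rew_limit k + W in the long run.
    Optimality compares it with every finite threshold policy from (k, 1). *)
Lemma optimal_inf_critical W (G : ethr K) k : G k = None ->
  optimal M W (thr_policy R G) -> critical_level W = rew_limit k.
Proof.
move=> Gk [_ opt]; apply/eqP; rewrite eq_le critical_level_ge_rew_limit andbT.
apply: critical_level_le => g.
have := opt _ (@thr_is_policy R K (fin_ethr g)) (k, 1%N) isT.
rewrite avg_reward_fin// => /le_trans /(_ (avg_reward_all_passive_le W Gk)).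
by rewrite lee_fin lerD2r.
Qed.

Lemma attained_separates W g : surplus M (critical_level W) g = W ->
  separates M (critical_level W) g.
Proof.
move=> gW; apply: surplus_maximal_separates => g'.
by rewrite gW critical_level_ub.
Qed.

End index.

(** * Indexability and Whittle's index *)

Section indexability.
Context (R : realType) (K : nat) (M : arm R K).
Implicit Types (g : 'I_K -> nat) (s : state K) (W c : R).

Local Notation p k := (steady M 0 k).
Local Notation r := (rew0 M).

Context (hp : steady_distribution (chan M) (steady M)).
Context (hp_pos : forall k : 'I_K, 0 < p k).
Context (hR : reward_assumption M).

(** Infinite components are absorbing and earn at least c + W per slot; from
    the other channels they are reached in a geometric number of cycles, so
    the loss before absorption is bounded. The subsolution is 0 on the
    absorbing channels and a constant x <= 0 elsewhere. *)
Lemma avg_reward_absorbing_ge W c (G : ethr K) k0 s : G k0 = None ->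
  (forall s, Pi s -> ~~ thr_action G s -> c <= r s.1 s.2) -> Pi s ->
  ((c + W)%:E <= avg_reward M W (thr_policy R G) s)%E.
Proof.
move=> Gk0 hpas Ps.
pose q := \sum_(k | G k == None) p k.
have q0 : 0 < q.
  rewrite /q (bigD1 k0) ?Gk0//=; apply: ltr_wpDr (hp_pos k0).
  by apply: sumr_ge0 => k _; exact: steady_ge0.
(* The largest x <= 0 for which the active action of a non-absorbing channel
   satisfies the Bellman inequality: x <= active_rew M - c - W + x * (1 - q). *)
pose x := Num.min 0 ((active_rew M - c - W) / q).
have x0 : x <= 0 by rewrite ge_min lexx.
have xq : x * q <= active_rew M - c - W.
  by rewrite -ler_pdivlMr// ge_min lexx orbT.
pose f (s : state K) : R := if G s.1 == None then 0 else x.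
have f0 s' : f s' <= 0 by rewrite /f; case: ifP.
have fE : \sum_k p k * f (k, 1%N) = x * (1 - q).
  have -> : 1 - q = \sum_(k | G k != None) p k.
    by rewrite -(steady_sum hp) (bigID (fun k => G k == None)) /= -/q [q + _]addrC addrK.
  rewrite (bigID (fun k => G k == None)) /=.
  rewrite big1 ?add0r => [|k /eqP Gk]; last by rewrite /f /= Gk mulr0.
  by rewrite mulr_sumr; apply: eq_bigr => k /negbTE Gk; rewrite /f /= Gk mulrC.
apply: (@avg_reward_ge _ _ _ _ _ _ _ (f s)) => n.
rewrite -[_ * _]subr0; apply: total_ge => //; first exact: thr_is_policy.
move=> l s' Ps'; rewrite decision_value_thr.
case: (boolP (thr_action G s')) => as' /=; last first.
  by have := hpas _ Ps' as'; rewrite /f /=; lra.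
have -> : f s' = x by rewrite /f; move: as'; rewrite /thr_action; case: (G s'.1).
by rewrite fE; lra.
Qed.

Context (hthr : forall W : R, exists G : ethr K, optimal M W (thr_policy R G)).

(** When the critical level is not attained by a finite vector, it equals the
    largest of the limits of the rewards, and staying passive in the channels
    that have this limit is optimal. Taking all of these channels makes the
    choice independent of W in that regime, hence nested. *)
Definition selected W (G : ethr K) : Prop := forall s, Pi s ->
  leo (Some s.2) (G s.1) = (critical_level M W < r s.1 s.2)
    || (`[< ~ attained M W >] && (rew_limit M s.1 == critical_level M W)).

Lemma selected_exists W : exists G, selected W G.
Proof.
have [|G hG] := @threshold_exists K (fun k t => (critical_level M W < r k t)
    || (`[< ~ attained M W >] && (rew_limit M k == critical_level M W))).
  move=> k t t' tt' /orP[h|->]; last by rewrite orbT.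
  by rewrite (lt_le_trans h)// rew0_le.
by exists G => s Ps; rewrite hG.
Qed.

Lemma selected_optimal W G : selected W G -> optimal M W (thr_policy R G).
Proof.
move=> sG; have [att|natt] := pselect (attained M W).
  have [g gW] := att.
  have [|g' hg'] := @superlevel_exists _ _ M hR (critical_level M W).
    by move=> k; exists (g k).+1 => //; apply: (attained_separates hp hp_pos hR gW).2.
  suff -> : G = fin_ethr g'.
    apply: attained_optimal => //; apply/eqP; rewrite eq_le critical_level_ub//=.
    rewrite -[leLHS]gW; apply: surplus_max => //; exact: superlevel_separates.
  apply: ethr_ext => k t t1; rewrite (sG (k, t) t1) /= -hg'//.
  by rewrite (asboolF (fun natt => natt att)) orbF.
have [G0 optG0] := hthr W.
(* An optimal finite vector would attain the critical level. *)
have [k0 Gk0] : exists k, G0 k = None.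
  apply: contrapT => /forallNP nG; apply: natt.
  have [g gG0] := fin_ethrP nG; exists g.
  by apply: optimal_fin_attained; rewrite -?gG0.
have ck0 := optimal_inf_critical hp hp_pos hR Gk0 optG0.
split=> [|u pu s Ps]; first exact: thr_is_policy.
apply: le_trans (avg_reward_le_critical hp hp_pos hR W pu Ps) _.
apply: (@avg_reward_absorbing_ge _ _ _ k0) => //.
  case Ek0 : (G k0) => [m|] //.
  by have := sG (k0, m.+1) isT; rewrite /= Ek0 ck0 eqxx asboolT//= ltnn orbT.
move=> s' Ps'; rewrite /thr_action negbK (sG _ Ps') => /orP[/ltW//|/andP[_ /eqP <-]].
exact: rew_limit_le.
Qed.

(** The delicate case is a state added because its channel has the critical
    limit. The critical level cannot decrease below this limit, so it is the
    same for W'; it is not attained at W', since a vector that attains it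
    there would have surplus W' > W at W. *)
Lemma selected_nested W W' G G' : W < W' -> selected W G -> selected W' G' ->
  passive_set G `<=` passive_set G'.
Proof.
move=> WW' sG sG' s [Ps]; rewrite (sG _ Ps) => h; split=> //; rewrite (sG' _ Ps).
have cc := critical_level_anti hp hR (ltW WW').
move: h => /orP[h|/andP[_ /eqP rc]]; first by rewrite (le_lt_trans cc h).
have c'E : critical_level M W' = critical_level M W.
  by apply/eqP; rewrite eq_le cc -rc critical_level_ge_rew_limit.
rewrite c'E rc eqxx andbT; apply/orP; right; apply/asboolP => -[g].
by rewrite c'E => gW'; have := critical_level_ub hp hR W g; rewrite gW' leNgt WW'.
Qed.

Lemma arm_indexable : indexable M.
Proof.
have [G hG] := choice selected_exists; exists G; split=> [W|W W' WW'].
  exact: selected_optimal.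
exact: (@selected_nested W W').
Qed.

Lemma superlevel_optimal c g (G : ethr K) : superlevel M c g ->
  (forall s, Pi s -> thr_action G s -> r s.1 s.2 <= c) ->
  (forall s, Pi s -> ~~ thr_action G s -> c <= r s.1 s.2) ->
  optimal M (surplus M c g) (thr_policy R G).
Proof.
move=> hg hact hpas; split=> [|u pu s Ps]; first exact: thr_is_policy.
apply: (@le_trans _ _ (c + surplus M c g)%:E).
  exact: avg_reward_separates_le (superlevel_separates hg) _ pu Ps.
apply: (@avg_reward_thr_ge _ _ _ hp _ _ g) => //.
  by move=> s' Ps' /(hact _ Ps'); rewrite leNgt -hg// -ltnNge.
by move=> s' Ps' as' _; exact: hpas.
Qed.

(** W < surplus c g says that the critical level at W is larger than c. An
    infinite component of G would have limit equal to this critical level,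
    against finiteness of g; a finite G that is passive in s would gain by
    giving up a state with reward below the critical level. *)
Lemma optimal_thr_active W c g (G : ethr K) s : superlevel M c g ->
  W < surplus M c g -> optimal M W (thr_policy R G) -> Pi s ->
  r s.1 s.2 <= c -> thr_action G s.
Proof.
move=> hg Wg opt Ps rs.
have c_lt : c < critical_level M W.
  rewrite -(ltr_pM2r (cycle_length_gt0 hp g)).
  by have := critical_level_ub hp hR W g; move: Wg; rewrite /surplus; lra.
have [[k Gk]|] := pselect (exists k, G k = None).
  have rk := optimal_inf_critical hp hp_pos hR Gk opt.
  have := hg k (g k).+1 isT; rewrite ltnn => /esym/negbT.
  rewrite -leNgt => /le_lt_trans/(_ c_lt); rewrite rk ltNge => /negP.
  by case; exact: rew_limit_le.
move=> /forallNP/fin_ethrP[g' Gg']; rewrite Gg' /thr_action /=; apply/negP => sg.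
have gW : surplus M (critical_level M W) g' = W.
  by apply: optimal_fin_attained; rewrite -?Gg'.
have := (attained_separates hp hp_pos hR gW).1 s.1 s.2.
by rewrite sg andbT => /(_ Ps) /(lt_le_trans c_lt); rewrite ltNge rs.
Qed.

(** The superlevel set g of c is active in s and the set where r >= c is
    passive in s; both separate the rewards at c, so both are optimal for the
    subsidy surplus c g. Minimality is [optimal_thr_active]. *)
Lemma superlevel_whittle_index c g (G : ethr K) s : superlevel M c g ->
  (forall s, Pi s -> leo (Some s.2) (G s.1) = (c <= r s.1 s.2)) ->
  Pi s -> r s.1 s.2 = c -> whittle_index M s (surplus M c g).
Proof.
move=> hg hG Ps rs; split; last first.
  move=> W [[G1 [opt1 pas1]] _]; rewrite leNgt; apply/negP => Wlt.
  by move/negP: pas1; apply; apply: (optimal_thr_active hg Wlt) => //; rewrite rs.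
split.
  exists G; split; last by rewrite /thr_action negbK hG// rs.
  apply: superlevel_optimal => // s' Ps'; rewrite /thr_action hG//.
    by rewrite -ltNge => /ltW.
  by rewrite negbK.
exists (fin_ethr g); split; last by rewrite /thr_action /= (hg _ _ Ps) rs ltxx.
apply: superlevel_optimal => // s' Ps'; rewrite /thr_action /= (hg _ _ Ps').
  by rewrite leNgt.
by rewrite negbK => /ltW.
Qed.

End indexability.

(** * Performance at infinite threshold vectors *)

Section limits.
Context (R : realType) (K : nat) (M : arm R K).
Context (alpha : ('I_K -> nat) -> state K -> R).
Implicit Types (g : 'I_K -> nat) (s : state K) (W c : R).

Local Notation p k := (steady M 0 k).
Local Notation r := (rew0 M).

Context (hp : steady_distribution (chan M) (steady M)).
Context (hp_pos : forall k : 'I_K, 0 < p k).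
Context (hR : reward_assumption M).
Context (halpha : forall g : 'I_K -> nat,
  thr_steady_state M (fin_ethr g) (alpha g)).

(** A family of threshold vectors whose channel k grows like m k times n; the
    components with m k = 0 may stay constant. The limit of the reward sums is
    part of the notion because growing components need Cesaro's lemma and
    constant ones do not. *)
Definition grows (gn : nat -> 'I_K -> nat) (m : 'I_K -> R) : Prop := forall k,
  ((gn n k)%:R / n%:R @[n --> \oo] --> m k) /\
  ((\sum_(1 <= t < (gn n k).+1) r k t) / n%:R @[n --> \oo] --> m k * rew_limit M k).

Section cycle_limits.
Context (gn : nat -> 'I_K -> nat) (m : 'I_K -> R).
Context (gm : grows gn m).
Context (m0 : 0 < \sum_k p k * m k).

Lemma cycle_length_div_cvg :
  cycle_length M (gn n) / n%:R @[n --> \oo] --> \sum_k p k * m k.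
Proof.
have -> : (fun n => cycle_length M (gn n) / n%:R) =
    (fun n => 1 / n%:R + \sum_k p k * ((gn n k)%:R / n%:R)).
  apply/funext => n; rewrite /cycle_length mulrDl mulr_suml; congr (_ + _).
  by apply: eq_bigr => k _; rewrite mulrA.
rewrite -[\sum_k p k * m k]add0r; apply: cvgD; first exact: cvg_div_nat.
by apply: cvg_sum_ord => k; apply: cvgMr; have [] := gm k.
Qed.

Lemma cycle_reward_div_cvg :
  cycle_reward M (gn n) / n%:R @[n --> \oo] --> \sum_k p k * (m k * rew_limit M k).
Proof.
have -> : (fun n => cycle_reward M (gn n) / n%:R) =
    (fun n => active_rew M / n%:R +
      \sum_k p k * ((\sum_(1 <= t < (gn n k).+1) r k t) / n%:R)).
  apply/funext => n; rewrite /cycle_reward mulrDl mulr_suml; congr (_ + _).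
  by apply: eq_bigr => k _; rewrite mulrA.
rewrite -[\sum_k p k * (m k * rew_limit M k)]add0r; apply: cvgD; first exact: cvg_div_nat.
by apply: cvg_sum_ord => k; apply: cvgMr; have [] := gm k.
Qed.

(** Dividing A and L by n leaves only the growing channels, where Cesaro means
    of the rewards tend to their limits. *)
Lemma cvg_Frew : Frew M alpha (gn n) @[n --> \oo] -->
  (\sum_k p k * (m k * rew_limit M k)) / (\sum_k p k * m k).
Proof.
have : (cycle_reward M (gn n) / n%:R) / (cycle_length M (gn n) / n%:R) @[n --> \oo]
    --> (\sum_k p k * (m k * rew_limit M k)) / (\sum_k p k * m k).
  apply: cvgM; first exact: cycle_reward_div_cvg.
  by apply: cvgV; [rewrite gt_eqF|exact: cycle_length_div_cvg].
apply: cvg_trans; apply: near_eq_cvg; near=> n.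
have n0 : 0 < n%:R :> R by rewrite ltr0n; near: n; exists 1%N.
have l0 := cycle_length_gt0 hp (gn n).
by rewrite (Frew_cycle hp halpha); field; rewrite !gt_eqF.
Unshelve. all: by end_near. Qed.

Lemma cvg_Spas : Spas alpha (gn n) @[n --> \oo] --> (1 : R).
Proof.
have : 1 - n%:R^-1 / (cycle_length M (gn n) / n%:R) @[n --> \oo]
    --> 1 - 0 / (\sum_k p k * m k).
  apply: cvgB; first exact: cvg_cst.
  apply: cvgM.
    by have := @cvg_div_nat R 1; under eq_fun do rewrite mul1r.
  by apply: cvgV; [rewrite gt_eqF|exact: cycle_length_div_cvg].
rewrite mul0r subr0; apply: cvg_trans; apply: near_eq_cvg; near=> n.
have n0 : 0 < n%:R :> R by rewrite ltr0n; near: n; exists 1%N.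
have l0 := cycle_length_gt0 hp (gn n).
by rewrite (Spas_cycle hp halpha); field; rewrite !gt_eqF.
Unshelve. all: by end_near. Qed.

End cycle_limits.

Lemma multiple_mean_cvg k m :
  (\sum_(1 <= t < (m * n).+1) r k t) / n%:R @[n --> \oo] --> m%:R * rew_limit M k.
Proof.
case: m => [|m].
  rewrite mul0r; have := @cvg_div_nat R 0; apply: cvg_trans.
  by apply: near_eq_cvg; apply: nearW => n; rewrite mul0n big_geq.
have moo : (m.+1 * n)%N @[n --> \oo] --> \oo.
  move=> A [N _ NA]; exists N => // n /= Nn; apply: NA => /=.
  by rewrite (leq_trans Nn)// leq_pmull.
have : m.+1%:R * ((\sum_(1 <= t < (m.+1 * n).+1) r k t) / (m.+1 * n)%:R)
    @[n --> \oo] --> m.+1%:R * rew_limit M k.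
  by apply: cvgMr; exact: (cvg_comp _ _ moo (@passive_mean_cvg _ _ _ hR k)).
apply: cvg_trans; apply: near_eq_cvg; apply: nearW => n /=.
rewrite natrM invfM mulrCA; congr (_ * _).
by rewrite mulrA mulfV ?mul1r// pnatr_eq0.
Qed.

Lemma grows_mul (m : 'I_K -> nat) :
  grows (fun n k => (m k * n)%N) (fun k => (m k)%:R).
Proof. by move=> k; split; [exact: multiple_ratio_cvg|exact: multiple_mean_cvg]. Qed.

Lemma grows_odflt (G : ethr K) :
  grows (fun n k => odflt n (G k)) (fun k => (G k == None)%:R).
Proof.
move=> k; case: (G k) => [x|] /=; rewrite ?mul0r.
  by split; exact: cvg_div_nat.
split; first by have := @multiple_ratio_cvg R 1%N; under eq_fun do rewrite mul1n.
by have := @multiple_mean_cvg k 1%N; under eq_fun do rewrite mul1n.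
Qed.

(** The probability that a restart enters a channel with infinite threshold. *)
Definition inf_weight (G : ethr K) : R := \sum_k p k * (G k == None)%:R.

(** The long-run reward once a channel with infinite threshold has been
    entered, averaged over which of them comes first. *)
Definition inf_mean (G : ethr K) : R :=
  (\sum_k p k * ((G k == None)%:R * rew_limit M k)) / inf_weight G.

Lemma inf_weight_gt0 G k : G k = None -> 0 < inf_weight G.
Proof.
move=> Gk; rewrite /inf_weight (bigD1 k)//= Gk mulr1 ltr_wpDr// sumr_ge0// => j _.
by rewrite mulr_ge0// ?steady_ge0// ler0n.
Qed.

Lemma extend_Frew_inf G k : G k = None -> extend (Frew M alpha) G = inf_mean G.
Proof.
move=> Gk; apply/cvg_lim => //.
exact: (@cvg_Frew _ _ (grows_odflt G) (inf_weight_gt0 Gk)).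
Qed.

Lemma extend_Spas_inf G k : G k = None -> extend (Spas alpha) G = 1.
Proof.
move=> Gk; apply/cvg_lim => //.
exact: (@cvg_Spas _ _ (grows_odflt G) (inf_weight_gt0 Gk)).
Qed.

Lemma extend_fin (f : ('I_K -> nat) -> R) g : extend f (fin_ethr g) = f g.
Proof. by rewrite /extend /fin_ethr /=; apply/cvg_lim => //; exact: cvg_cst. Qed.

(** The value of ratio does not depend on the finite components of G: they
    are negligible in the limit. This is what excludes a largest minimiser with
    both finite and infinite components. *)
Lemma ratio_inf g G k : G k = None ->
  Defs.ratio M alpha (fin_ethr g) G = cycle_reward M g - inf_mean G * cycle_length M g.
Proof.
move=> Gk; rewrite /Defs.ratio !extend_fin (extend_Frew_inf Gk) (extend_Spas_inf Gk).
rewrite (Frew_cycle hp halpha) (Spas_cycle hp halpha).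
by have l0 := cycle_length_gt0 hp g; rewrite subKr invrK; field; rewrite gt_eqF.
Qed.

(** Valid for every c. With c such that g maximises the surplus, the second
    term is non-negative and vanishes exactly on the maximisers. *)
Lemma ratio_fin c g g' : cycle_length M g < cycle_length M g' ->
  Defs.ratio M alpha (fin_ethr g) (fin_ethr g') = surplus M c g +
    cycle_length M g * ((surplus M c g - surplus M c g') /
                        (cycle_length M g' - cycle_length M g)).
Proof.
move=> ll; rewrite /Defs.ratio !extend_fin !(Frew_cycle hp halpha) !(Spas_cycle hp halpha).
have l0 := cycle_length_gt0 hp g; have l0' := cycle_length_gt0 hp g'.
rewrite /surplus; field.
by rewrite !gt_eqF// subr_gt0.
Qed.

(** If all thresholds tend to infinity but channel j grows twice as fast, its
    limit counts double in the mean. Independence of the limit from the growth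
    rates thus forces each limit to equal the common mean. *)
Lemma limits_exist_rew_limit : limits_exist M alpha ->
  exists l, forall k, rew_limit M k = l.
Proof.
move=> hlim; exists (extend (Frew M alpha) (fun=> None)) => j.
set l := extend _ _.
have key (m : 'I_K -> nat) : (forall k, (0 < m k)%N) ->
    \sum_k p k * ((m k)%:R * rew_limit M k) = l * \sum_k p k * (m k)%:R.
  move=> m0.
  have w0 : 0 < \sum_k p k * (m k)%:R.
    rewrite (bigD1 j)//= ltr_wpDr ?mulr_gt0 ?ltr0n// sumr_ge0// => k _.
    by rewrite mulr_ge0// ?steady_ge0.
  have toG : tends_to (fun n k => (m k * n)%N) (fun=> None).
    move=> k A [N _ NA]; exists N => // n /= Nn; apply: NA => /=.
    by rewrite (leq_trans Nn)// leq_pmull.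
  have /cvg_lim := hlim _ _ toG; have /cvg_lim -> // := @cvg_Frew _ _ (grows_mul m) w0.
  by rewrite -/l => <- //; rewrite divfK// gt_eqF.
have sum_inf : \sum_k p k * rew_limit M k = l.
  (* equal growth rates *)
  have := key (fun=> 1%N) (fun=> isT).
  under eq_bigr do rewrite mul1r; under [in RHS]eq_bigr do rewrite mulr1.
  by rewrite steady_sum// mulr1.
(* channel j grows at twice the rate of the others *)
have := key (fun k => ((k == j).+1)%N) (fun=> isT).
have -> : \sum_k p k * ((k == j).+1%:R * rew_limit M k) =
    \sum_k p k * rew_limit M k + p j * rew_limit M j.
  rewrite [in LHS](bigD1 j)//= [in RHS](bigD1 j)//= eqxx /=.
  rewrite (eq_bigr (fun k => p k * rew_limit M k)) => [|k /negbTE ->]; first by ring.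
  by rewrite mul1r.
have -> : \sum_k p k * (k == j).+1%:R = \sum_k p k + p j.
  rewrite [in LHS](bigD1 j)//= [in RHS](bigD1 j)//= eqxx /=.
  rewrite (eq_bigr (fun k => p k)) => [|k /negbTE ->]; first by ring.
  by rewrite mulr1.
rewrite sum_inf steady_sum// mulrDr mulr1 => /addrI; rewrite mulrC.
by apply: mulIf; rewrite gt_eqF.
Qed.

End limits.

(** * The algorithm *)

Section algorithm.
Context (R : realType) (K : nat) (M : arm R K).
Context (alpha : ('I_K -> nat) -> state K -> R).
Implicit Types (g : 'I_K -> nat) (s : state K) (v : R).

Local Notation p k := (steady M 0 k).
Local Notation r := (rew0 M).

Context (hp : steady_distribution (chan M) (steady M)).
Context (hp_pos : forall k : 'I_K, 0 < p k).
Context (hR : reward_assumption M).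
Context (halpha : forall g : 'I_K -> nat,
  thr_steady_state M (fin_ethr g) (alpha g)).

(** The invariant of the algorithm: v is the largest reward that is not yet
    passive under g, and all larger rewards are. *)
Definition next_level v g : Prop :=
  superlevel M v g /\ exists k, r k (g k).+1 = v.

Lemma next_level_exists g :
  (forall j k t, (1 <= t <= g k)%N -> r j (g j).+1 < r k t) ->
  exists v, next_level v g.
Proof.
move=> hg; pose k0 := Ordinal (channels_gt0 hp).
pose k1 := [arg max_(k > k0) r k (g k).+1]%O.
have k1P k : r k (g k).+1 <= r k1 (g k1).+1.
  by rewrite /k1; case: arg_maxP => // i _; apply.
exists (r k1 (g k1).+1); split; last by exists k1.
move=> k t t1; case: leqP => tg; first by rewrite hg// t1.
by apply/esym/negbTE; rewrite -leNgt; apply: le_trans (k1P k); apply: rew0_le.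
Qed.

Lemma cycle_length_lt g g' : (forall k, g k <= g' k)%N -> g' <> g ->
  cycle_length M g < cycle_length M g'.
Proof.
move=> gg' ne; have [k gk] : exists k, (g k < g' k)%N.
  apply: contrapT => /forallNP h; apply: ne; apply/funext => k.
  by apply/eqP; rewrite eqn_leq gg' andbT leqNgt; apply/negP.
rewrite /cycle_length ltrD2l (bigD1 k)//= [ltRHS](bigD1 k)//=.
apply: ltr_leD; first by rewrite ltr_pM2l// ltr_nat.
by apply: ler_sum => j _; rewrite ler_wpM2l ?steady_ge0// ler_nat.
Qed.

Lemma ratio_ge v g g' : superlevel M v g -> le_ethr (fin_ethr g) (fin_ethr g') ->
  g' <> g -> surplus M v g <= Defs.ratio M alpha (fin_ethr g) (fin_ethr g').
Proof.
move=> hg gg' ne; have ll := cycle_length_lt gg' ne.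
rewrite (ratio_fin hp halpha v ll) lerDl mulr_ge0 ?(ltW (cycle_length_gt0 hp g))//.
by rewrite divr_ge0 ?subr_ge0 ?(ltW ll)// surplus_max//; exact: superlevel_separates.
Qed.

Lemma ratio_eqP v g g' : le_ethr (fin_ethr g) (fin_ethr g') -> g' <> g ->
  Defs.ratio M alpha (fin_ethr g) (fin_ethr g') = surplus M v g <->
  surplus M v g' = surplus M v g.
Proof.
move=> gg' ne; have ll := cycle_length_lt gg' ne.
rewrite (ratio_fin hp halpha v ll); split=> [|->]; last by rewrite subrr mul0r mulr0 addr0.
move/eqP; rewrite -subr_eq0 addrAC subrr add0r !mulf_eq0 invr_eq0 !subr_eq0.
by rewrite (gt_eqF (cycle_length_gt0 hp g)) (gt_eqF ll) orbF/= => /eqP.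
Qed.

Lemma surplus_eq_ge v g g' k t : superlevel M v g -> surplus M v g' = surplus M v g ->
  (1 <= t <= g' k)%N -> v <= r k t.
Proof.
move=> hg gg'; apply: (surplus_maximal_separates hp_pos hR _).1 => g''.
by rewrite gg' surplus_max//; exact: superlevel_separates.
Qed.

(** By monotonicity all states of channel k between g k and t have reward v,
    so making them passive changes nothing at the level v. *)
Lemma surplus_set_threshold_eq v g k t : superlevel M v g -> (g k < t)%N -> r k t = v ->
  surplus M v (set_threshold g k t) = surplus M v g.
Proof.
move=> hg gt rt; have [hge hle] := superlevel_separates hg.
apply: separates_surplus_eq => //; split=> j u; rewrite /set_threshold; case: eqP => [->|_].
- by rewrite -[X in X <= _]rt => h; apply: rew0_le.
- exact: hge.
- by move=> tu; rewrite hle// (ltn_trans gt).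
- exact: hle.
Qed.

Lemma ereal_inf_ratio v g : next_level v g ->
  ereal_inf [set (Defs.ratio M alpha (fin_ethr g) (fin_ethr g'))%:E
            | g' in Tset (fin_ethr g)] = (surplus M v g)%:E.
Proof.
move=> [hg [k rk]]; apply/eqP; rewrite eq_le; apply/andP; split.
  apply: ereal_inf_lbound; exists (set_threshold g k (g k).+1).
    split; first exact: le_set_threshold.
    by move=> /fin_ethr_inj; exact: set_threshold_neq.
  congr EFin; apply/ratio_eqP; [exact: le_set_threshold|exact: set_threshold_neq|].
  exact: surplus_set_threshold_eq.
apply: le_ereal_inf_tmp => _ [g' [gg' ne] <-]; rewrite lee_fin.
by apply: ratio_ge => // e; apply: ne; rewrite e.
Qed.

(** Beyond g all rewards are at most v, so a mean of limits can equal v only if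
    each of these limits does. *)
Lemma inf_mean_eq v g (G : ethr K) k : superlevel M v g -> inf_mean M G = v ->
  G k = None -> rew_limit M k = v.
Proof.
move=> hg mG Gk.
have w0 := inf_weight_gt0 hp hp_pos Gk.
have le_v j : rew_limit M j <= v.
  apply: (@le_trans _ _ (r j (g j).+1)); first exact: rew_limit_le.
  by rewrite leNgt -hg// ltnn.
have sum0 : \sum_j p j * ((G j == None)%:R * (v - rew_limit M j)) = 0.
  under eq_bigr do rewrite mulrBr mulrBr.
  rewrite sumrB; apply/eqP; rewrite subr_eq0; apply/eqP.
  rewrite -[RHS](divfK (lt0r_neq0 w0)) -/(inf_mean M G) mG /inf_weight mulr_sumr.
  by apply: eq_bigr => j _; ring.
have term0 j : 0 <= p j * ((G j == None)%:R * (v - rew_limit M j)).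
  by rewrite mulr_ge0 ?steady_ge0// mulr_ge0 ?ler0n// subr_ge0.
have := psumr_eq0P (fun j _ => term0 j) sum0 (i := k) isT; rewrite Gk eqxx mul1r.
by move/eqP; rewrite mulf_eq0 gt_eqF//= subr_eq0 => /eqP ->.
Qed.

Lemma minimizer_infP v g (G : ethr K) k : G k = None ->
  Defs.ratio M alpha (fin_ethr g) G = surplus M v g <-> inf_mean M G = v.
Proof.
move=> Gk; rewrite (ratio_inf hp hp_pos hR halpha g Gk) /surplus; split=> [|->//].
move/addrI/oppr_inj; apply: mulIf.
by rewrite gt_eqF// cycle_length_gt0.
Qed.

Lemma inf_mean_support (G G' : ethr K) :
  (forall k, (G k == None) = (G' k == None)) -> inf_mean M G = inf_mean M G'.
Proof.
move=> h; rewrite /inf_mean /inf_weight; congr (_ / _).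
  by apply: eq_bigr => k _; rewrite h.
by apply: eq_bigr => k _; rewrite h.
Qed.

(** A largest minimiser contains every state with reward at least v, because
    the vector extended up to that state alone is a minimiser. Conversely a
    finite minimiser maximises the surplus at v and so contains no reward below
    v. If the minimiser has an infinite component, raising a finite component
    by one would give a larger minimiser, so all components are infinite, and
    the rewards beyond g are constantly v. *)
Lemma alg_step_level v g w (G : ethr K) : next_level v g ->
  alg_step M alpha (fin_ethr g) w G ->
  [/\ w = surplus M v g,
      forall s, Pi s -> leo (Some s.2) (G s.1) = (v <= r s.1 s.2) &
      stopped G \/ exists g', G = fin_ethr g'].
Proof.
move=> nl [winf [leG neG rG] large].
have wE : w = surplus M v g by apply: EFin_inj; rewrite winf (ereal_inf_ratio nl).
have [hg _] := nl; rewrite wE in rG large *.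
have passive_of_ge k t : (1 <= t)%N -> v <= r k t -> leo (Some t) (G k).
  move=> t1 vt; have [tg|gt] := leqP t (g k).
    by have := leG k; rewrite /fin_ethr; case: (G k) => //= m; exact: leq_trans.
  have rt : r k t = v.
    by apply/eqP; rewrite eq_le vt andbT leNgt -hg// -ltnNge.
  have : minimizer M alpha (fin_ethr g) (surplus M v g) (fin_ethr (set_threshold g k t)).
    split; first exact/le_set_threshold/ltnW.
      by move=> /fin_ethr_inj; exact: set_threshold_neq.
    by apply/ratio_eqP; [exact/le_set_threshold/ltnW|exact: set_threshold_neq|exact: surplus_set_threshold_eq].
  by move=> /large /(_ k); rewrite /fin_ethr /set_threshold eqxx.
have [[k Gk]|/forallNP/fin_ethrP[g' Gg']] := pselect (exists k, G k = None).
  have mG : inf_mean M G = v by exact: (minimizer_infP v g Gk).1.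
  have st : stopped G.
    move=> j; case Ej : (G j) => [m|] //.
    (* A minimiser with the same infinite components that is not below G. *)
    pose G' : ethr K := fun i => if i == j then Some m.+1 else G i.
    have G'k : G' k = None.
      by rewrite /G'; case: eqP => // kj; move: Gk; rewrite kj Ej.
    have : minimizer M alpha (fin_ethr g) (surplus M v g) G'.
      split.
      - move=> i; have := leG i; rewrite /G'; case: eqP => [->|//].
        by rewrite Ej /fin_ethr /=; exact: leqW.
      - by move=> e; move: G'k; rewrite e.
      - apply/(minimizer_infP v g G'k); rewrite -mG; apply: inf_mean_support => i.
        by rewrite /G'; case: (eqVneq i j) => [->|//]; rewrite Ej.
    by move=> /large /(_ j); rewrite /G' eqxx Ej /= ltnn.
  split=> //; last by left.
  move=> s Ps; rewrite st /=; apply/esym.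
  by rewrite -(inf_mean_eq hg mG (st s.1)) rew_limit_le.
split=> //; last by right; exists g'.
have ne : g' <> g by move=> e; apply: neG; rewrite Gg' e.
have sg' : surplus M v g' = surplus M v g.
  by apply/(ratio_eqP v _ ne); [rewrite -Gg'|rewrite -Gg'].
move=> s Ps; apply/idP/idP; last exact: passive_of_ge.
rewrite Gg' /= => sg; apply: (surplus_eq_ge hg sg'); rewrite sg andbT; exact: Ps.
Qed.

Lemma next_level_step v g' :
  (forall s, Pi s -> leo (Some s.2) (fin_ethr g' s.1) = (v <= r s.1 s.2)) ->
  exists v', next_level v' g'.
Proof.
move=> hg'; apply: next_level_exists => // j k t /andP[t1 tg].
have := hg' (k, t) t1; rewrite /= tg => /esym; apply: lt_le_trans.
by have := hg' (j, (g' j).+1) isT; rewrite /= ltnn => /esym/negbT; rewrite -ltNge.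
Qed.

(** All the limits are a common l <= v. If l = v, all rewards beyond g equal v
    and the all-infinite vector minimises; if l < v, the set where r >= v is
    finite and infinite vectors are not minimisers. *)
Lemma alg_step_exists v g : next_level v g -> limits_exist M alpha ->
  exists w G, alg_step M alpha (fin_ethr g) w G.
Proof.
move=> nl hlim; have [l hl] := limits_exist_rew_limit hp hp_pos hR halpha hlim.
have [hg [k0 rk0]] := nl; exists (surplus M v g).
have l_le : l <= v by rewrite -rk0 -(hl k0) rew_limit_le.
have [vl|lv] := leP v l.
  have {vl} vl : v = l by apply/eqP; rewrite eq_le vl l_le.
  exists (fun=> None); split; first by rewrite (ereal_inf_ratio nl).
    split=> //; first by move=> /(congr1 (@^~ k0)).
    apply/(minimizer_infP v g (k := k0)) => //.
    rewrite /inf_mean /inf_weight; under eq_bigr do rewrite mul1r hl.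
    under [X in _ / X]eq_bigr do rewrite mulr1.
    by rewrite -mulr_suml steady_sum// mul1r divr1.
  by move=> G2 _ k.
have [|G hG] := @threshold_exists K (fun k t => v <= r k t).
  by move=> k t t' tt' /le_trans; apply; exact: rew0_le.
have [|g' Gg'] := @fin_ethrP K G.
  move=> k Gk; have [t t1 rt] : exists2 t, (1 <= t)%N & r k t < v.
    by apply: rew0_lt => //; rewrite hl.
  by have := hG k t t1; rewrite Gk /= leNgt rt.
have hg' k t : (1 <= t)%N -> (t <= g' k)%N = (v <= r k t).
  by move=> t1; rewrite -hG// Gg'.
have gg' k : (g k <= g' k)%N.
  case: (posnP (g k)) => [->//|gk].
  by rewrite hg'// ltW// -hg.
have ne : g' <> g.
  move=> e; have := hg' k0 (g k0).+1 isT.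
  by rewrite e ltnn rk0 lexx.
exists (fin_ethr g'); split; first by rewrite (ereal_inf_ratio nl).
  split=> //; first by move/fin_ethr_inj.
  apply/(ratio_eqP v) => //; apply: separates_surplus_eq => //; last exact: superlevel_separates.
  split=> k t; first by move=> /andP[t1]; rewrite hg'.
  by move=> gt; rewrite ltW// ltNge -hg'// -?ltnNge// (leq_ltn_trans _ gt).
move=> G2 [leG2 neG2 rG2].
have [[k Gk]|/forallNP/fin_ethrP[g2 Gg2]] := pselect (exists k, G2 k = None).
  have /(inf_mean_eq hg)/(_ Gk) : inf_mean M G2 = v by exact: (minimizer_infP v g Gk).1.
  by rewrite hl => lv'; move: lv; rewrite lv' ltxx.
rewrite Gg2 in leG2 neG2 rG2 *.
have ne2 : g2 <> g by move=> e; apply: neG2; rewrite e.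
have sg2 := (ratio_eqP v leG2 ne2).1 rG2.
move=> k /=; case: (posnP (g2 k)) => [->//|g2k].
by rewrite hg'// (surplus_eq_ge hg sg2)// g2k leqnn.
Qed.

Lemma alg_run_level n G w : alg_run M alpha n G w ->
  forall i, (i <= n)%N ->
  stopped (G i) \/ exists g v, G i = fin_ethr g /\ next_level v g.
Proof.
move=> [G0 run]; elim=> [|i IH] i_n.
  right; have [|v hv] := @next_level_exists (fun=> 0%N).
    by move=> j k [|t].
  by exists (fun=> 0%N), v.
have [nst step] := run i i_n.
have [//|[g [v [Gg nl]]]] := IH (ltnW i_n).
rewrite Gg in step.
have [_ hG [?|[g' Gg']]] := alg_step_level nl step; [by left|right].
rewrite Gg' in hG *; have [v' nl'] := next_level_step hG.
by exists g', v'.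
Qed.

(** Along the run each state starts active and ends passive, so the first step
    at which it is passive assigns a value. *)
Lemma assigned_exists n G (w : nat -> R) s : G 0%N = fin_ethr (fun=> 0%N) ->
  stopped (G n) -> Pi s -> exists v, assigned n G w s v.
Proof.
move=> G0 st Ps.
have hn : leo (Some s.2) (G n s.1) by rewrite st.
have ex : exists i, leo (Some s.2) (G i s.1) by exists n.
case: (ex_minnP ex) => -[|i] hi imin.
  by move: hi; rewrite G0 /=; move: Ps; rewrite /Pi /=; case: (s.2).
exists (w i), i; split=> //; first exact: imin.
by apply/negP => /imin; rewrite ltnn.
Qed.

Context (hthr : forall W : R, exists G : ethr K, optimal M W (thr_policy R G)).

Lemma assigned_whittle n G w s v : alg_run M alpha n G w ->
  Pi s -> assigned n G w s v -> whittle_index M s v.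
Proof.
move=> run Ps [i [i_n act pas ->]].
have [nst step] := run.2 i i_n.
have [//|[g [c [Gg nl]]]] := alg_run_level run (ltnW i_n).
rewrite Gg in step act.
have [-> hG _] := alg_step_level nl step.
have [hg _] := nl.
apply: (superlevel_whittle_index hp hp_pos hR hg hG) => //.
apply/eqP; rewrite eq_le -(hG _ Ps) pas andbT leNgt -hg//.
Qed.

End algorithm.

Theorem theorem3 (R : realType) (K : nat) (M : arm R K)
    (alpha : ('I_K -> nat) -> state K -> R)
    (hK : (1 <= K)%N)
    (hP : stochastic (chan M))
    (hp : steady_distribution (chan M) (steady M))
    (hp_pos : forall k : 'I_K, 0 < steady M 0 k)
    (hR : reward_assumption M)
    (halpha : forall g : 'I_K -> nat,
       thr_steady_state M (fin_ethr g) (alpha g))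
    (hthr : forall W : R, exists G : ethr K, optimal M W (thr_policy R G))
    (hS : forall g g' : 'I_K -> nat, (forall k, (g k <= g' k)%N) ->
       Spas alpha g <= Spas alpha g') :
  indexable M /\
  (forall (n : nat) (G : nat -> ethr K) (w : nat -> R),
     alg_run M alpha n G w ->
     [/\ forall (s : state K) (v : R),
           Pi s -> assigned n G w s v -> whittle_index M s v,
         stopped (G n) ->
           forall s : state K, Pi s -> exists v : R, assigned n G w s v &
         limits_exist M alpha -> ~ stopped (G n) ->
           exists (v : R) (G' : ethr K), alg_step M alpha (G n) v G']).
Proof.
split; first exact: arm_indexable.
move=> n G w run; split.
- by move=> s v; exact: (assigned_whittle (alpha := alpha)).
- by move=> st s; apply: assigned_exists => //; case: run.
move=> hlim nst.
have [//|[g [v [-> nl]]]] := alg_run_level hp hp_pos hR halpha run (leqnn n).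
exact: alg_step_exists nl hlim.
Qed.
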